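(* Let $p$ be a prime, and suppose that a $p$-group $P$ acts by automorphisms on a finite group $G$. Let $N\trianglelefteq G$ be a $P$-invariant normal subgroup such that $G/N$ is a $p'$-group, and let $N\le C\le G$ be the subgroup defined by $C/N=\mathbf{C}_{G/N}(P)$. Then there exists a natural bijection ${}^*:\mathrm{Irr}_P(G)\to\mathrm{Irr}_P(C)$. In fact, if $\chi\in\mathrm{Irr}_P(G)$, then $$\chi_C=e\chi^*+p\Delta+\Xi,$$ where each of $\Delta$ and $\Xi$ is a character of $C$ or zero, $p$ does not divide the integer $e$, and no irreducible constituent of $\Xi$ lies over some $P$-invariant irreducible character of $N$. In fact, $e\equiv\pm1\pmod p$. In particular, $\mathbb{Q}(\chi)=\mathbb{Q}(\chi^* )$. Also, if $\chi$ has $p'$-degree, then $\chi$ lies in the principal $p$-block of $G$ if and only if $\chi^*$ lies in the principal $p$-block of $C$.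
   Context: $\mathrm{Irr}_P(G)$ denotes the set of $P$-invariant irreducible complex characters of $G$ (similarly for $C$). $\mathbf{C}_{G/N}(P)$ is the subgroup of fixed points of the induced action of $P$ on $G/N$. $\chi_C$ denotes restriction to $C$. A character of $C$ lies over $\theta\in\mathrm{Irr}(N)$ if $\theta$ is a constituent of its restriction to $N$. $\mathbb{Q}(\chi)$ is the smallest field containing the values of $\chi$. A $p'$-group is a finite group of order not divisible by $p$; a character has $p'$-degree if its degree is not divisible by $p$. The principal $p$-block is the $p$-block containing the trivial character. *)

(* Defs.v *)
From mathcomp Require Import all_boot all_order all_fingroup all_algebra.
From mathcomp Require Import all_solvable all_field all_character.

Set Implicit Arguments.
Unset Strict Implicit.
Unset Printing Implicit Defensive.

Import Order.TTheory GroupScope GRing.Theory Num.Theory.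
Local Open Scope ring_scope.

(* Complex characters are the algC-valued characters of the library.          *)

Section InvariantCharacters.

Variables (aT gT : finGroupType) (P : {group aT}) (G : {group gT}).
Variable to : groupAction P G.

(* Meant for subgroups H of G stable under the action of P.                   *)
Definition invIirr (H : {group gT}) : {set Iirr H} :=
  [set i | [forall a in P, [forall x in H, 'chi_i (to x a) == 'chi_i x]]].

(* Since 0 \is a character, Delta and Xi may vanish. No sign condition is put *)
(* on e.                                                                      *)
Definition res_decomp (p : nat) (N C : {group gT}) (i : Iirr G) (j : Iirr C)
    (e : int) (Delta Xi : 'CF(C)) : Prop :=
  [/\ Delta \is a character, Xi \is a character,
      'Res[C] 'chi_i = e%:~R *: 'chi_j + p%:R *: Delta + Xi,
      ~~ (p%:Z %| e)%Z
    & forall k t, k \in irr_constt Xi -> t \in invIirr N ->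
        t \notin irr_constt ('Res[N] 'chi_k)].

End InvariantCharacters.

(* Membership in Q(phi), the intersection of the subfields of algC containing *)
(* the values of phi: as x / 0 = 0, divring_closed K says that K is a         *)
(* subfield.                                                                  *)
Definition in_char_field (gT : finGroupType) (G : {group gT}) (phi : 'CF(G))
    (z : algC) : Prop :=
  forall K : {pred algC},
    GRing.divring_closed K -> {in G, forall x, phi x \in K} -> z \in K.

(* Ideals of the ring Aint of algebraic integers.                             *)
Definition Aint_ideal (M : {pred algC}) : Prop :=
  [/\ {subset M <= Aint}, 0 \in M, {in M &, forall x y, x + y \in M}
    & {in Aint & M, forall a x, a * x \in M}].

Definition Aint_maximal_ideal (M : {pred algC}) : Prop :=
  [/\ Aint_ideal M, 1 \notin M
    & forall I : {pred algC}, Aint_ideal I -> {subset M <= I} ->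
        1 \notin I -> {subset I <= M}].

(* chi_i and chi_j lie in the same p-block when their central characters      *)
(*   omega_chi(K^) = #|K| chi(x_K) / chi(1),   K a class, K^ its class sum,   *)
(* agree modulo a maximal ideal M of Aint containing p. The resulting         *)
(* partition of Irr(G) does not depend on M, whence the quantification.       *)
Definition same_block (p : nat) (gT : finGroupType) (G : {group gT})
    (i j : Iirr G) : Prop :=
  forall M : {pred algC}, Aint_maximal_ideal M -> p%:R \in M ->
    forall k : 'I_#|classes G|, 'omega_i['K_k] - 'omega_j['K_k] \in M.

(* 'chi_0 is the trivial character.                                           *)
Definition in_principal_block (p : nat) (gT : finGroupType) (G : {group gT})
    (i : Iirr G) : Prop :=
  same_block p i 0.

(* Main.v *)
Require Import Defs.
From HB Require Import structures.
From mathcomp Require Import all_boot all_order all_fingroup all_algebra.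
From mathcomp Require Import all_solvable all_field all_character.
From mathcomp Require Import ring.
From mathcomp Require boolp.

Set Implicit Arguments.
Unset Strict Implicit.
Unset Printing Implicit Defensive.

Import Order.TTheory GroupScope GRing.Theory Num.Theory.
Local Open Scope ring_scope.

(** For chi in Irr_P(G) and psi in Irr_P(C), let a(chi, psi) be the multiplicity
of psi in chi_C.  The theorem says that, modulo p, the matrix a is a signed
permutation matrix: chi^star is the only psi for which a(chi, psi) is prime to
p, and then a(chi, psi) is 1 or -1 modulo p.  The remaining constituents of
chi_C that lie over P-invariant characters of N are P-invariant [irr_over_inv],
so that p divides their multiplicities and they make up p Delta; the
constituents over no such character make up Xi.  Since a P-invariant character
of C lies over a P-invariant character of N [invariant_constt_exists], such a
decomposition determines chi^star.

All the congruences come from one principle, [coset_sum_fixC].  The group P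
permutes the cosets of N in G, and those that it fixes are the cosets inside C.
The sums of a P-invariant function over the cosets in an orbit are equal, and
nontrivial orbits have length divisible by p.  Hence the function has the same
sum over G and over C modulo p, after division of both sums by |N|, provided
that its average over each coset of N is an algebraic integer.  As |G : N| is
prime to p, indices can be cancelled.  The principle is applied three times.
 - To |chi|^2 [row_nonzero]: each row of a has an entry prime to p.
 - To the sum defining the restriction to C of the induced character psi^G
   [column_orthogonality]: the columns of a are orthonormal modulo p.
 - To the convolution of two distinct characters chi and chi', paired with psi
   [column_uniqueness]: the convolution vanishes on G, and its analogue on C is
   the product a(chi, psi) a(chi', psi) up to factors prime to p.  Hence each
   column has at most one entry prime to p.
Together these leave exactly one entry prime to p in each row and each column,
and that entry has square 1 modulo p.

Integrality of the averages is hard only for the convolution.  The Clifford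
correspondence reduces it to the case where chi, chi' and psi lie over a
G-invariant character theta of N.  Then theta extends to the group generated by
N and x for each x, and on the coset of x the three characters are algebraic
integers times the trace of such an extension [invariant_coset_values].  The matrices that extend theta multiply up to a root
of unity [cocycle_integral], after which the sum over N can be evaluated with
Schur's lemma.

Uniqueness makes the bijection commute with field automorphisms, so Galois
theory gives the equality of the fields of values.  For the blocks, let S be a
Sylow p-subgroup of G and U the set of p'-elements of C_G(S), which is a group
because C_G(S) is the product of Z(S) and a p'-group.  A character of p'-degree
lies in the principal block if and only if the sum of its values over U is not
divisible by p [principal_blockP].  One can choose S inside N and P-invariant;
modulo p the sum over U of chi is then a sum over the fixed points of P, which
lie in C, and there chi agrees with a(chi, chi^star) chi^star modulo p
[star_fixed_value]. *)

(** * Congruences and sums over orbits of a p-group *)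

Lemma eqAmod_sum (I : Type) (r : seq I) (Q : pred I) (e : algC) (F H : I -> algC) :
    (forall i, Q i -> (F i == H i %[mod e])%A) ->
  (\sum_(i <- r | Q i) F i == \sum_(i <- r | Q i) H i %[mod e])%A.
Proof.
move=> eqFH; elim/big_ind2: _ => // x1 x2 y1 y2; exact: eqAmodD.
Qed.

(** By Bezout, n is invertible modulo p in the ring of algebraic integers. *)
Lemma eqAmod0_mulIn (p n : nat) (x : algC) :
    coprime p n -> (0 < p)%N -> x \in Aint ->
  (x * n%:R == 0 %[mod p])%A -> (x == 0 %[mod p])%A.
Proof.
move=> co_pn p0 Zx.
have [n0|n0] := posnP n.
  move: co_pn; rewrite n0 /coprime gcdn0 => /eqP->.
  by move=> _; rewrite eqAmod0 unfold_in oner_eq0 divr1.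
case: (egcdnP p n0) => u v def_uv _; rewrite gcdnC (eqP co_pn) in def_uv.
move=> /(eqAmodMr (rpred_nat Aint u)); rewrite mul0r -mulrA -natrM mulnC def_uv.
rewrite natrD mulrDr mulr1 natrM mulrA; apply: eqAmod_trans.
by rewrite eqAmod_sym eqAmod_addl_mul // rpredM ?rpred_nat.
Qed.

(** The summands of a nontrivial orbit are equal, and its length is a positive
power of p. *)
Lemma pgroup_sum_fix (p : nat) (aT : finGroupType) (D A : {group aT}) (T : finType)
    (to : action D T) (S : {set T}) (F : T -> algC) :
    prime p -> p.-group A -> A \subset D -> {in S & A, forall x a, to x a \in S} ->
    {in S, forall x, F x \in Aint} ->
    {in S & A, forall x a, F (to x a) = F x} ->
  (\sum_(x in S) F x == \sum_(x in S | x \in 'Fix_to(A)) F x %[mod p])%A.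
Proof.
move=> p_pr pA sAD actS ZF invF.
have actsAS: [acts A, on S | to].
  apply/subsetP=> a Aa; rewrite !inE (subsetP sAD) //; apply/subsetP=> x Sx.
  by rewrite inE actS.
rewrite (bigID [in 'Fix_to(A)]) /= -[X in (_ == X %[mod _])%A]addr0 eqAmodDl.
pose S' := S :\: 'Fix_to(A).
have actS': [acts A, on S' | to].
  apply: actsD actsAS _; have:= acts_subnorm_fix to A.
  by rewrite (setIidPr sAD); apply: subset_trans; rewrite subsetI sAD normG.
rewrite (eq_bigl [in S']) => [|x]; last by rewrite !inE andbC.
rewrite -(cover_partition (orbit_partition actS')).
have /and3P[_ triv _] := orbit_partition actS'.
rewrite big_trivIset //=.
have sum0 : \sum_(O in orbit to A @: S') 0 = 0 :> algC by rewrite big1_eq.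
rewrite -[X in (_ == X %[mod _])%A]sum0.
apply: eqAmod_sum => _ /imsetP[x S'x ->].
have [Sx notFx] := setDP S'x.
rewrite (eq_bigr (fun _ => F x)) => [|_ /imsetP[a Aa ->]]; last exact: invF.
rewrite sumr_const -mulr_natr.
have: p.-nat #|A : 'C_A[x | to]| := pnat_dvd (dvdn_indexg _ _) pA.
rewrite -card_orbit_in // => /p_natP[[|k]].
  move/eqP; rewrite expn0 => /eqP/card_orbit1/orbit1P fix_x.
  by rewrite fix_x in notFx.
by move=> ->; rewrite expnS natrM mulrCA; apply: eqAmodMr0; rewrite rpredM ?rpred_nat ?ZF.
Qed.

Lemma sum_coset_mulr (gT : finGroupType) (N K : {group gT}) (f : gT -> algC) x :
    N <| K -> x \in K ->
  \sum_(y in K | coset N y == coset N x) f y = \sum_(n in N) f (x * n)%g.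
Proof.
case/andP=> sNK nNK Kx; rewrite (reindex_inj (mulgI x)); apply: eq_bigl => n.
rewrite groupMl //; have nNx := subsetP nNK x Kx.
have [Kn | notKn] := boolP (n \in K); last first.
  by apply/esym; apply: contraNF notKn; apply: (subsetP sNK).
have nNn := subsetP nNK n Kn.
rewrite morphM // -[X in _ == X]mulg1 (inj_eq (mulgI _)).
by apply/eqP/idP=> [/coset_idr-> // | /coset_id].
Qed.

Lemma sum_cosets (gT : finGroupType) (N K : {group gT}) (f : gT -> algC) :
    N <| K ->
  \sum_(x in K) f x = \sum_(A in (K / N)%g) \sum_(n in N) f (repr A * n)%g.
Proof.
move=> nsNK; rewrite (partition_big (coset N) [in (K / N)%g]) /= => [|x Kx]; last first.
  exact: mem_quotient.
apply: eq_bigr => A KA; have [x nNx Kx DA] := morphimP KA.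
have repA : repr A \in K.
  have: repr A \in N :* x by rewrite -val_coset // -DA mem_repr_coset.
  by case/rcosetP=> n Nn ->; rewrite groupM // (subsetP (normal_sub nsNK)).
by rewrite -(sum_coset_mulr f nsNK repA) coset_reprK.
Qed.

(** * Automorphisms acting on irreducible characters *)

Section Twist.

Variables (aT gT : finGroupType) (P : {group aT}) (G : {group gT}).
Variable to : groupAction P G.
Variable H : {group gT}.
Hypotheses (sHG : H \subset G) (nHP : [acts P, on H | to]).

Lemma act_memE a x : a \in P -> (to x a \in H) = (x \in H).
Proof. by move=> Pa; apply: (acts_act nHP). Qed.

Lemma sum_act a (F : gT -> algC) :
  a \in P -> \sum_(x in H) F (to x a) = \sum_(x in H) F x.
Proof. by move=> Pa; rewrite [RHS](reindex_acts _ nHP Pa). Qed.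

Lemma cfdot_twist a (phi psi phi' psi' : 'CF(H)) : a \in P ->
    {in H, forall x, phi' x = phi (to x a)} ->
    {in H, forall x, psi' x = psi (to x a)} ->
  '[phi', psi'] = '[phi, psi].
Proof.
move=> Pa Dphi Dpsi; rewrite !cfdotE; congr (_ * _).
rewrite -[RHS](sum_act _ Pa); apply: eq_bigr => x Hx.
by rewrite Dphi ?Dpsi.
Qed.

Lemma twist_irr_exists a (i : Iirr H) : a \in P ->
  {j : Iirr H | [forall x in H, 'chi_j x == 'chi_i (to x a)]}.
Proof.
move=> Pa; apply: sigW.
have repr_to : mx_repr H (fun x => 'Chi_i (to x a)).
  split=> [|x y Hx Hy]; first by rewrite (gact1 to Pa) repr_mx1.
  by rewrite gactM ?(subsetP sHG) // repr_mxM ?act_memE.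
pose rH := MxRepresentation repr_to.
have DrH : {in H, forall x, cfRepr rH x = 'chi_i (to x a)}.
  by move=> x Hx; rewrite -irrRepr !cfunE act_memE // Hx.
have /irrP[j Dj]: cfRepr rH \in irr H.
  rewrite irrEchar cfRepr_char /=.
  by rewrite (cfdot_twist Pa DrH DrH) cfnorm_irr.
by exists j; apply/'forall_in_eqP=> x Hx; rewrite -Dj DrH.
Qed.

(** The inverse makes this a right action.  Outside P it must still be injective
in the character to give an action structure, hence the identity. *)
Definition Iirr_act (i : Iirr H) a :=
  odflt i [pick j | (a \in P) && [forall x in H, 'chi_j x == 'chi_i (to x a^-1%g)]].

Lemma Iirr_actE i a x :
  a \in P -> x \in H -> 'chi_(Iirr_act i a) x = 'chi_i (to x a^-1%g).
Proof.
move=> Pa Hx; rewrite /Iirr_act Pa; case: pickP => [j /'forall_in_eqP-> // |].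
by have [|j Dj /(_ j)] := @twist_irr_exists a^-1%g i; rewrite ?groupV //= Dj.
Qed.

Lemma Iirr_act_is_action : is_action P Iirr_act.
Proof.
split=> [a i j | i a b Pa Pb].
  have [Pa | notPa] := boolP (a \in P).
    move=> eq_ij; apply/irr_inj/cfun_inP=> x Hx.
    have:= congr1 (fun k : Iirr H => 'chi_k (to x a)) eq_ij.
    by rewrite /= !Iirr_actE ?act_memE // actKin.
  by rewrite /Iirr_act (negPf notPa); case: pickP => //; case: pickP.
apply/irr_inj/cfun_inP=> x Hx.
by rewrite !Iirr_actE ?groupM ?act_memE ?groupV // invMg actMin ?groupV.
Qed.
Canonical Iirr_action := Action Iirr_act_is_action.

Lemma invIirrP (i : Iirr H) :
  reflect {in P & H, forall a x, 'chi_i (to x a) = 'chi_i x} (i \in invIirr to H).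
Proof.
rewrite inE; apply: (iffP forall_inP) => inv_i => [a x Pa Hx | a Pa].
  by have /'forall_in_eqP-> := inv_i a Pa.
by apply/'forall_in_eqP=> x Hx; apply: inv_i.
Qed.

Lemma fix_Iirr_action : 'Fix_Iirr_action(P) = invIirr to H.
Proof.
apply/setP=> i; apply/afixP/invIirrP => [fix_i a x Pa Hx | inv_i a Pa].
  by rewrite -{1}(fix_i a Pa) Iirr_actE ?act_memE // actKin.
by apply/irr_inj/cfun_inP=> x Hx; rewrite Iirr_actE ?inv_i ?groupV.
Qed.

Lemma sum_invIirr (p : nat) (F : Iirr H -> algC) :
    prime p -> p.-group P -> (forall i, F i \in Aint) ->
    (forall a i j, a \in P -> {in H, forall x, 'chi_j x = 'chi_i (to x a)} ->
       F j = F i) ->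
  (\sum_i F i == \sum_(i in invIirr to H) F i %[mod p])%A.
Proof.
move=> p_pr pP ZF invF.
have sumE (Q : pred (Iirr H)) : \sum_(i | Q i) F i = \sum_(i in setT | Q i) F i.
  by apply: eq_bigl => i; rewrite inE.
rewrite -fix_Iirr_action (sumE [in _]) (sumE predT).
rewrite (eq_bigl [in setT]) => [|i]; last by rewrite !inE.
apply: pgroup_sum_fix => // i a _ Pa.
by apply: (invF a^-1%g); rewrite ?groupV // => x Hx; apply: Iirr_actE.
Qed.

End Twist.

(** * Averages and convolutions of characters *)

(** In an irreducible representation the sum of the elements of N commutes with
H, hence is a scalar e by Schur's lemma, and it squares to |N| times itself.  So
e is 0 or |N|, and the average of the character over hN is 0 or its value at h. *)
Lemma Aint_coset_average (gT : finGroupType) (H N : {group gT}) (phi : 'CF(H)) h :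
    N <| H -> phi \is a character -> h \in H ->
  #|N|%:R^-1 * (\sum_(n in N) phi (h * n)%g) \in Aint.
Proof.
move=> nsNH Nphi Hh; have [sNH nNH] := andP nsNH.
have [r ->] := char_sum_irr Nphi.
under eq_bigr do rewrite sum_cfunE.
rewrite exchange_big mulr_sumr rpred_sum // => i _.
pose rG := 'Chi_i; pose E := \sum_(n in N) rG n.
have irrG : mx_absolutely_irreducible rG by apply/groupC/socle_irr.
have sumE : \sum_(n in N) 'chi_i (h * n)%g = \tr (rG h *m E).
  rewrite mulmx_sumr raddf_sum; apply: eq_bigr => n Nn /=.
  have Hn := subsetP sNH n Nn.
  by rewrite -repr_mxM // -irrRepr cfunE groupM.
have cE : centgmx rG E.
  apply/centgmxP=> x Hx; rewrite mulmx_suml mulmx_sumr.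
  have actsN : [acts H, on N | 'J] by rewrite astabsJ.
  rewrite [RHS](reindex_acts _ actsN Hx) /=.
  apply: eq_bigr => n Nn; have Hn := subsetP sNH n Nn.
  by rewrite -!repr_mxM ?groupJ // -conjgC.
have [e DE] := is_scalar_mxP (mx_abs_irr_cent_scalar irrG cE).
have EE : E *m E = #|N|%:R *: E.
  rewrite {1}/E mulmx_suml scaler_nat -sumr_const; apply: eq_bigr => n Nn.
  rewrite mulmx_sumr [RHS](reindex_inj (mulgI n)); apply: eq_big => m.
    by rewrite groupMl.
  by move=> Nm; rewrite repr_mxM ?(subsetP sNH).
have ee : e = 0 \/ e = #|N|%:R.
  move: EE; rewrite DE -scalar_mxM scale_scalar_mx => /matrixP.
  have n_gt0 : (0 < irr_degree (socle_of_Iirr i))%N by apply: irr_degree_gt0.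
  move=> /(_ (Ordinal n_gt0) (Ordinal n_gt0)) /eqP; rewrite !mxE eqxx -subr_eq0 -mulrBl mulf_eq0.
  by rewrite subr_eq0 orbC => /orP[]/eqP; [left | right].
rewrite sumE DE mul_mx_scalar mxtraceZ.
case: ee => ->; rewrite ?(mul0r, mulr0) // mulKf ?neq0CG //.
by have:= Aint_irr i h; rewrite -irrRepr cfunE Hh.
Qed.

(** The convolution of two distinct irreducible characters is 0, and that of
'chi_j with itself is a multiple of 'chi_j. *)
Lemma convolution_irr (gT : finGroupType) (L : {group gT}) (phi psi : 'CF(L)) (j : Iirr L) :
  \sum_(c in L) (\sum_(x in L) phi x * psi (x^-1 * c)%g) * ('chi_j c)^*
    = '[phi, 'chi_j] * '[psi, 'chi_j] * (#|L|%:R ^+ 2 / 'chi_j 1%g).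
Proof.
have conv k l c : \sum_(x in L) 'chi[L]_k x * 'chi_l (x^-1 * c)%g
    = #|L|%:R * (l == k)%:R * ('chi_l c / 'chi_l 1%g).
  rewrite -mulrA -generalized_orthogonality_relation mulVKf ?neq0CG //.
  rewrite [RHS](reindex_inj invg_inj); apply: eq_big => x; first by rewrite groupV.
  by rewrite invgK mulrC.
transitivity (\sum_(c in L) (\sum_k \sum_l '[phi, 'chi_k] * '[psi, 'chi_l] *
     (\sum_(x in L) 'chi_k x * 'chi_l (x^-1 * c)%g)) * ('chi_j c)^*).
  apply: eq_bigr => c Lc; congr (_ * _).
  under [RHS]eq_bigr do under eq_bigr do rewrite mulr_sumr.
  under [RHS]eq_bigr do rewrite exchange_big.
  rewrite [RHS]exchange_big; apply: eq_bigr => x Lx.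
  rewrite {1}[phi]cfun_sum_cfdot {1}[psi]cfun_sum_cfdot !sum_cfunE mulr_suml.
  apply: eq_bigr => k _; rewrite mulr_sumr; apply: eq_bigr => l _.
  by rewrite !cfunE mulrACA.
under eq_bigr => c Lc.
  under eq_bigr => k _.
    rewrite (bigD1 k) //= conv eqxx mulr1 big1 ?addr0 => [|l /negPf ne_lk]; last first.
      by rewrite conv ne_lk mulr0 mul0r mulr0.
    over.
  rewrite mulr_suml.
  over.
have term k : \sum_(c in L) '[phi, 'chi_k] * '[psi, 'chi_k] * (#|L|%:R * ('chi_k c / 'chi_k 1%g))
      * ('chi_j c)^* = '[phi, 'chi_k] * '[psi, 'chi_k] * (#|L|%:R ^+ 2 / 'chi_k 1%g) * (k == j)%:R.
  rewrite -cfdot_irr cfdotE [RHS]mulrA [RHS]mulr_sumr; apply: eq_bigr => c _.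
  by field; rewrite irr1_neq0 neq0CG.
rewrite exchange_big (bigD1 j) //= term eqxx mulr1 big1 ?addr0 // => k /negPf ne_kj.
by rewrite term ne_kj mulr0.
Qed.

(** * Extending an invariant character to a cyclic extension *)

Section CyclicExtension.

Variables (gT : finGroupType) (N : {group gT}) (t : Iirr N) (x : gT).
Hypotheses (nNx : x \in 'N(N)) (inv_x : {in N, forall n, 'chi_t (n ^ x)%g = 'chi_t n}).

Variables (d : nat) (D : mx_representation algC N d).
Hypothesis chiD : cfRepr D = 'chi_t.

Lemma irr_of_cfRepr : mx_absolutely_irreducible D.
Proof.
apply/groupC; have simD : mx_rsim 'Chi_t D by apply: cfRepr_inj; rewrite irrRepr.
exact: mx_rsim_irr simD (socle_irr _).
Qed.

Let d_gt0 : (0 < d)%N.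
Proof. by rewrite -ltC_nat -(cfRepr1 D) chiD irr1_gt0. Qed.
Let k := #[coset N x].
Let NJx n : n \in N -> (n ^ x)%g \in N. Proof. by rewrite memJ_norm. Qed.

Lemma irr_comm_scalar (B : 'M[algC]_d) :
  {in N, forall n, D n *m B = B *m D n} -> exists c, B = c%:M.
Proof.
move=> cB; apply/is_scalar_mxP/(mx_abs_irr_cent_scalar irr_of_cfRepr).
by apply/centgmxP=> n Nn; rewrite cB.
Qed.

Lemma intertwiner_exists :
  exists2 B : 'M[algC]_d, B \in unitmx & {in N, forall n, D n *m B = B *m D (n ^ x)%g}.
Proof.
have reprJ : mx_repr N (fun n => D (n ^ x)%g).
  split=> [|n m Nn Nm]; first by rewrite conj1g repr_mx1.
  by rewrite conjMg repr_mxM ?NJx.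
have [|B _ freeB DB] := @cfRepr_inj _ _ _ _ D (MxRepresentation reprJ).
  by apply/cfun_inP=> n Nn; rewrite [RHS]cfunE Nn chiD -inv_x // -chiD cfunE NJx.
by exists B; rewrite // -row_free_unit.
Qed.

Lemma mem_expg_coset m : (x ^+ m \in N)%g = (k %| m)%N.
Proof.
rewrite order_dvdn -morphX //; apply/idP/eqP=> [/coset_id // | /coset_idr-> //].
exact: groupX.
Qed.

Lemma intertwiner_expg (B : 'M[algC]_d) m :
    {in N, forall n, D n *m B = B *m D (n ^ x)%g} ->
  {in N, forall n, D n *m (B ^+ m) = (B ^+ m) *m D (n ^ (x ^+ m))%g}.
Proof.
move=> DB; elim: m => [|m IHm] n Nn.
  by rewrite !expr0 expg0 conjg1 mulmx1 mul1mx.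
have -> : B ^+ m.+1 = B ^+ m *m B by rewrite exprSr.
rewrite mulmxA IHm // -!mulmxA; congr (_ *m _).
by rewrite DB ?memJ_norm ?groupX // -conjgM expgSr.
Qed.

(** If B intertwines D with its conjugate by x, then B^k and D(x^k) intertwine
the same irreducible representations, so they differ by a scalar, of which a
k-th root can be taken off B. *)
Lemma normalized_intertwiner_exists :
  exists tau : 'M[algC]_d,
    [/\ {in N, forall n, D n *m tau = tau *m D (n ^ x)%g} & tau ^+ k = D (x ^+ k)%g].
Proof.
have [B uB DB] := intertwiner_exists.
have Nxk : (x ^+ k)%g \in N by rewrite mem_expg_coset.
have [c Dc] : exists c, B ^+ k *m D (x ^- k)%g = c%:M.
  apply: irr_comm_scalar => n Nn; rewrite mulmxA intertwiner_expg //.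
  have nNxk : (x ^+ k)%g \in 'N(N) by rewrite groupX.
  rewrite -!mulmxA -!repr_mxM ?groupV ?memJ_norm //.
  by rewrite /conjg mulgA mulgK.
have DBk : B ^+ k = c *: D (x ^+ k)%g.
  by rewrite -mul_scalar_mx -Dc -mulmxA -repr_mxM ?groupV // mulVg repr_mx1 mulmx1.
have nz_c : c != 0.
  have: B ^+ k \in unitmx by elim: (k) => [|m IHm]; rewrite ?unitmx1 // exprS unitmx_mul uB.
  apply: contraTneq => c0; rewrite DBk c0 scale0r; apply/negP=> /mulmxV.
  rewrite mul0mx => /(congr1 mxtrace)/esym/eqP.
  by rewrite mxtrace0 mxtrace1 pnatr_eq0 eqn0Ngt d_gt0.
pose b := k.-root c.
have bk : b ^+ k = c by rewrite rootCK ?order_gt0.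
exists (b^-1 *: B); split=> [n Nn|].
  by rewrite -scalemxAr DB // scalemxAl.
have exprZ m : (b^-1 *: B) ^+ m = b^-1 ^+ m *: B ^+ m.
  elim: m => [|m IHm]; first by rewrite scale1r.
  rewrite [LHS]exprS IHm [in RHS]exprS [in RHS]exprS.
  by rewrite -[LHS]/(_ *m _) -scalemxAl -scalemxAr scalerA.
by rewrite exprZ DBk scalerA exprVn bk mulVf ?scale1r.
Qed.

(** The extension maps x^i n to tau^i D(n); the normalization of tau makes this
independent of the choice of i and n. *)
Lemma cyclic_extension :
  exists rH : mx_representation algC (N <*> <[x]>) d, {in N, forall n, rH n = D n}.
Proof.
have [tau [Dtau tau_k]] := normalized_intertwiner_exists.
pose H := (N <*> <[x]>)%G.
have HP h : reflect (exists i, exists2 n, n \in N & h = (x ^+ i * n)%g) (h \in H).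
  apply: (iffP idP) => [|[i [n Nn ->]]]; last first.
    by rewrite groupM ?groupX ?mem_gen // inE ?cycle_id ?Nn ?orbT.
  rewrite /H /= norm_joinEr ?cycle_subG // => /mulsgP[n _ Nn /cycleP[i ->] ->].
  by exists i; exists (n ^ (x ^+ i))%g; rewrite ?memJ_norm ?groupX // -conjgC.
have tauX m : (x ^+ m \in N)%g -> tau ^+ m = D (x ^+ m)%g.
  rewrite mem_expg_coset => /dvdnP[q ->]; rewrite mulnC exprM tau_k expgM.
  have Nxk : (x ^+ k)%g \in N by rewrite mem_expg_coset.
  elim: q => [|q IHq]; first by rewrite repr_mx1.
  rewrite exprS IHq expgS repr_mxM //; exact: groupX.
have tauD i j : (x ^- j * x ^+ i \in N)%g -> tau ^+ j *m D (x ^- j * x ^+ i)%g = tau ^+ i.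
  have [le_ji | /ltnW le_ij] := leqP j i.
    rewrite -{1 2}(subnKC le_ji) expgD mulKg => Nx.
    by rewrite -tauX // -[_ *m _]/(_ * _) -exprD subnKC.
  rewrite -(subnKC le_ij) expgD invMg -mulgA mulVg mulg1 groupV => Nx.
  rewrite exprD -[_ * _]/(_ *m _) (tauX _ Nx) -mulmxA -repr_mxM ?groupV //.
  by rewrite mulgV repr_mx1 mulmx1.
(* The default 0 of i_ is only reached outside the group generated by N and x. *)
pose i_ h := oapp (@nat_of_ord _) 0%N [pick i : 'I_#[x] | x ^- i * h \in N]%g.
pose r h := tau ^+ i_ h *m D (x ^- i_ h * h)%g.
have rE i n : n \in N -> r (x ^+ i * n)%g = tau ^+ i *m D n.
  move=> Nn; have Nj : (x ^- i_ (x ^+ i * n) * x ^+ i \in N)%g.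
    rewrite /i_; case: pickP => [j /=|]; first by rewrite mulgA groupMr.
    have /cyclePmin[j lt_j Dj] := mem_cycle x i.
    by move=> /(_ (Ordinal lt_j)); rewrite /= -Dj mulKg Nn.
  by rewrite /r mulgA repr_mxM // mulmxA tauD.
have reprH : mx_repr H r.
  split=> [|_ _ /HP[i [n Nn ->]] /HP[j [m Nm ->]]].
    by have:= rE 0%N 1%g (group1 N); rewrite mulg1 expg0 repr_mx1 mulmx1.
  rewrite mulgA -(mulgA (x ^+ i)%g) (conjgC n) mulgA -expgD -mulgA.
  have NJ : (n ^ (x ^+ j) \in N)%g by rewrite memJ_norm ?groupX.
  rewrite !rE ?(groupM NJ Nm) // repr_mxM // exprD -[_ * _]/(_ *m _).
  by rewrite -!mulmxA (mulmxA (D n)) intertwiner_expg // !mulmxA.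
exists (MxRepresentation reprH) => n Nn /=.
by have:= rE 0%N n Nn; rewrite expg0 mul1g mul1mx.
Qed.

End CyclicExtension.

(** * Values on cosets and triple products *)

(** By Gallagher's theorem 'chi_j is 'chi_c times a character of H / N, whose
value is constant on xN. *)
Lemma Gallagher_coset (gT : finGroupType) (N H : {group gT}) (t : Iirr N) (c j : Iirr H) x :
    N <| H -> x \in H -> 'Res[N] 'chi_c = 'chi_t ->
    t \in irr_constt ('Res[N] 'chi_j) ->
  exists2 s, s \in Aint & {in N, forall n, 'chi_j (x * n)%g = s * 'chi_c (x * n)%g}.
Proof.
move=> nsNH Hx Nc; rewrite -constt_Ind_Res.
have [irr_mul _ -> _] := constt_Ind_ext nsNH Nc => /codomP[b ->].
exists ('chi_b (coset N x)) => [|n Nn]; first exact: Aint_irr.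
have Hn := subsetP (normal_sub nsNH) n Nn.
rewrite cfIirrE ?irr_mul // cfunE mod_IirrE // cfModE ?groupM //.
by rewrite coset_kerr.
Qed.

(** Since 'chi_t is invariant, each constituent of the restriction of 'chi_i to
the group generated by N and x lies over 'chi_t, and Gallagher's theorem applies
to each. *)
Lemma invariant_coset_values (gT : finGroupType) (N K : {group gT}) (t : Iirr N) i x
    (c : Iirr (N <*> <[x]>)) :
    N <| K -> K \subset 'I['chi_t] -> x \in K -> 'Res[N] 'chi_c = 'chi_t ->
    t \in irr_constt ('Res[N, K] 'chi_i) ->
  exists2 s, s \in Aint & {in N, forall n, 'chi_i (x * n)%g = s * 'chi_c (x * n)%g}.
Proof.
move=> nsNK IKt Kx Nc iNt; have [sNK nNK] := andP nsNK.
have sHK : N <*> <[x]> \subset K by rewrite join_subG sNK cycle_subG.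
have sNH : N \subset N <*> <[x]> by apply: joing_subl.
have nsNH : N <| N <*> <[x]> := normalS sNH sHK nsNK.
have Hx : x \in (N <*> <[x]>)%G by rewrite mem_gen // inE cycle_id orbT.
pose Q (phi : 'CF(N <*> <[x]>)) := exists2 s, s \in Aint
  & {in N, forall n, phi (x * n)%g = s * 'chi_c (x * n)%g}.
suffices [s Zs Ds]: Q ('Res 'chi_i).
  exists s => // n Nn; rewrite -Ds // cfResE // groupM //; exact: subsetP sNH n Nn.
have DN : 'Res[N] 'chi_i = '['Res[N] 'chi_i, 'chi_t] *: 'chi_t.
  by rewrite {1}(Clifford_Res_sum_cfclass nsNK iNt) cfclass_invariant ?big_seq1.
rewrite ['Res _]cfun_sum_constt; apply: (big_ind Q) => [|phi psi|j].
- by exists 0; rewrite ?rpred0 // => n _; rewrite cfunE mul0r.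
- move=> [s1 Zs1 Ds1] [s2 Zs2 Ds2]; exists (s1 + s2); first exact: rpredD.
  by move=> n Nn; rewrite cfunE Ds1 ?Ds2 // mulrDl.
move=> ij; have Ni := cfRes_char (N <*> <[x]>) (irr_char i).
have jNt : t \in irr_constt ('Res[N] 'chi_j).
  have [u jNu] := neq0_has_constt (Res_irr_neq0 N j).
  have:= constt_Res_trans Ni ij jNu; rewrite cfResRes // DN.
  rewrite irr_consttE cfdotZl cfdot_irr mulf_eq0 negb_or => /andP[_].
  by rewrite pnatr_eq0 eqb0 negbK => /eqP->.
have [s Zs Ds] := Gallagher_coset nsNH Hx Nc jNt.
exists ('['Res 'chi_i, 'chi_j] * s).
  by rewrite rpredM // Aint_Cnat // Cnat_cfdot_char_irr.
by move=> n Nn; rewrite cfunE Ds // mulrA.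
Qed.

Section Cocycle.

Variables (gT : finGroupType) (N : {group gT}) (t : Iirr N).
Variables (d : nat) (D : mx_representation algC N d).
Hypothesis chiD : cfRepr D = 'chi_t.

Let d_gt0 : (0 < d)%N.
Proof. by rewrite -ltC_nat -(cfRepr1 D) chiD irr1_gt0. Qed.
Let nz_d : d%:R != 0 :> algC. Proof. by rewrite pnatr_eq0 -lt0n. Qed.

(** The orthogonality relations for matrix coefficients: the matrices D(n) span
the full matrix algebra, and for A = 1 the sum is a scalar by Schur's lemma. *)
Lemma Schur_sum (A : 'M[algC]_d) :
  \sum_(n in N) \tr (A *m D n) *: D n^-1%g = (#|N|%:R / d%:R) *: A.
Proof.
have [a ->] : exists a, A = \sum_(m in N) a m *: D m.
  apply/envelop_mxP; have /andP[_ full] := irr_of_cfRepr chiD.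
  by apply: submx_full.
rewrite scaler_sumr.
under eq_bigr do rewrite mulmx_suml raddf_sum /= scaler_suml.
rewrite exchange_big /=; apply: eq_bigr => m Nm.
pose E := \sum_(n in N) \tr (D n) *: D n^-1%g.
have [e De] : exists e, E = e%:M.
  apply: (irr_comm_scalar chiD) => n Nn; rewrite mulmx_suml mulmx_sumr.
  have actsN : [acts N, on N | 'J] by rewrite astabsJ normG.
  rewrite (reindex_acts _ actsN Nn) /=; apply: eq_bigr => k Nk.
  have Nkn : (k ^ n)%g \in N by rewrite groupJ.
  rewrite -scalemxAr -scalemxAl; congr (_ *: _); last first.
    by rewrite -!repr_mxM ?groupV // -conjVg -conjgC.
  have trE g : g \in N -> \tr (D g) = 'chi_t g by move=> Ng; rewrite -chiD cfunE Ng.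
  by rewrite !trE ?cfunJ.
have -> : \sum_(n in N) \tr ((a m *: D m) *m D n) *: D n^-1%g = a m *: (E *m D m).
  rewrite mulmx_suml scaler_sumr [RHS](reindex_inj (mulgI m)).
  apply: eq_big => n; first by rewrite groupMl.
  move=> Nn; rewrite -scalemxAl mxtraceZ -scalerA -scalemxAl -!repr_mxM ?groupV ?groupM //.
  by rewrite invMg mulgKV.
have De' : e = #|N|%:R / d%:R.
  apply: (mulIf nz_d); rewrite divfK // mulr_natr -mxtrace_scalar -De raddf_sum /=.
  under eq_bigr => n Nn.
    rewrite mxtraceZ; have -> : \tr (D n) = 'chi_t n by rewrite -chiD cfunE Nn.
    have -> : \tr (D n^-1%g) = 'chi_t n^-1%g by rewrite -chiD cfunE groupV Nn.
    over.
  have := first_orthogonality_relation t t; rewrite eqxx => /(canRL (mulVKf (neq0CG N))).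
  by rewrite mulr1.
by rewrite De mul_scalar_mx De' !scalerA mulrC.
Qed.

Lemma det_repr_unity (H : {group gT}) (rH : mx_representation algC H d) x :
  x \in H -> \det (rH x) ^+ #[x] = 1.
Proof.
move=> Hx; rewrite -(lin_char_unity_root (cfDet_lin_char (cfRepr rH)) Hx).
by rewrite cfDetRepr cfunE Hx /= mxtrace_scalar.
Qed.

Lemma intertwine_restr (H : {group gT}) (rH : mx_representation algC H d) x :
    N \subset H -> x \in H -> x \in 'N(N) -> {in N, rH =1 D} ->
  {in N, forall n, D n *m rH x = rH x *m D (n ^ x)%g}.
Proof.
move=> sNH Hx nNx DH n Nn; have Nnx : (n ^ x)%g \in N by rewrite memJ_norm.
have [Hn Hnx] := (subsetP sNH n Nn, subsetP sNH _ Nnx).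
by rewrite -!DH // -!repr_mxM // -conjgC.
Qed.

(** On cosets of N, extensions of D to cyclic extensions of N form a projective
representation: X Y = alpha Z for the matrices X, Y, Z of x, y, x y.  Their
determinants are roots of unity, hence so is alpha.  [Schur_sum] contracts the
inner sum, and what remains is alpha times the average over a coset of the
character |rZ|^2. *)
Lemma cocycle_integral (x y : gT)
    (rX : mx_representation algC (N <*> <[x]>) d)
    (rY : mx_representation algC (N <*> <[y]>) d)
    (rZ : mx_representation algC (N <*> <[x * y]>) d) :
    x \in 'N(N) -> y \in 'N(N) ->
    {in N, rX =1 D} -> {in N, rY =1 D} -> {in N, rZ =1 D} ->
  d%:R / #|N|%:R ^+ 2 * (\sum_(n in N) \sum_(m in N)
     cfRepr rX (x * n)%g * cfRepr rY (n^-1 * y * m)%g * (cfRepr rZ (x * y * m)%g)^* ) \in Aint.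
Proof.
move=> nNx nNy DX DY DZ.
have sN z : N \subset (N <*> <[z]>)%G by apply: joing_subl.
have Hz z : z \in (N <*> <[z]>)%G by rewrite mem_gen // inE cycle_id orbT.
have nNxy : (x * y)%g \in 'N(N) by rewrite groupM.
set X := rX x; set Y := rY y; set Z := rZ (x * y)%g.
have uZ : Z \in unitmx by apply: repr_mx_unit.
have intX := intertwine_restr (sN x) (Hz x) nNx DX.
have intY := intertwine_restr (sN y) (Hz y) nNy DY.
have intZ := intertwine_restr (sN _) (Hz _) nNxy DZ.
have trR z (r : mx_representation algC (N <*> <[z]>) d) n : n \in N ->
    {in N, r =1 D} -> cfRepr r (z * n)%g = \tr (r z *m D n).
  move=> Nn Dr; have Hn := subsetP (sN z) n Nn.
  by rewrite cfunE groupM // repr_mxM // (Dr n Nn).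
have [alpha Dalpha] : exists alpha, X *m Y *m invmx Z = alpha%:M.
  apply: (irr_comm_scalar chiD) => n Nn; have Nnx : (n ^ x)%g \in N by rewrite memJ_norm.
  rewrite !mulmxA intX // -(mulmxA X (D (n ^ x)%g)) intY // -!mulmxA; congr (_ *m (_ *m _)).
  by rewrite -conjgM; apply: (canLR (mulmxK uZ)); rewrite -mulmxA intZ // mulKmx.
have XY : X *m Y = alpha *: Z by rewrite -mul_scalar_mx -Dalpha mulmxKV.
have Zalpha : alpha \in Aint.
  pose M := (#[x] * #[y] * #[(x * y)%g])%N.
  have M_gt0 : (0 < M)%N by rewrite !muln_gt0 !order_gt0.
  apply: (@Aint_unity_root (d * M)); first by rewrite muln_gt0 d_gt0.
  apply/unity_rootP; have := congr1 (fun A => \det A ^+ M) XY.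
  rewrite det_mulmx detZ !exprMn -exprM.
  have detM z (r : mx_representation algC (N <*> <[z]>) d) : (#[z] %| M)%N -> \det (r z) ^+ M = 1.
    by case/dvdnP=> q ->; rewrite mulnC exprM det_repr_unity // expr1n.
  have dvM : [/\ #[x] %| M, #[y] %| M & #[(x * y)%g] %| M]%N.
    rewrite /M; split; first by rewrite -mulnA dvdn_mulr.
      by rewrite dvdn_mulr ?dvdn_mull.
    by rewrite dvdn_mull.
  by case: dvM => dx dy dz; rewrite (detM x rX) // (detM y rY) // (detM _ rZ) // !mulr1.
have -> : \sum_(n in N) \sum_(m in N)
     cfRepr rX (x * n)%g * cfRepr rY (n^-1 * y * m)%g * (cfRepr rZ (x * y * m)%g)^*
   = #|N|%:R / d%:R * alpha * (\sum_(m in N) (cfRepr rZ * (cfRepr rZ)^*%CF) (x * y * m)%g).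
  rewrite exchange_big mulr_sumr; apply: eq_bigr => m Nm.
  have -> (phi : 'CF(N <*> <[x * y]>)) g : (phi * phi^*%CF) g = phi g * (phi g)^* by rewrite !cfunE.
  rewrite -mulr_suml mulrA; congr (_ * _).
  have -> : cfRepr rZ (x * y * m)%g = \tr (Z *m D m) by rewrite trR.
  rewrite -mulrA -mxtraceZ scalemxAl -XY -mxtraceZ -mulmxA scalemxAl -Schur_sum.
  rewrite mulmx_suml raddf_sum; apply: eq_bigr => n Nn /=.
  have Nn' : n^-1%g \in N by rewrite groupV.
  rewrite trR // -scalemxAl mxtraceZ; congr (_ * _).
  have Ny k : k \in N -> k \in (N <*> <[y]>)%G := subsetP (sN y) k.
  have [Hn' Hm Hy] := And3 (Ny _ Nn') (Ny _ Nm) (Hz y).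
  rewrite cfunE groupM ?(groupM Hn') // repr_mxM ?(groupM Hn') // repr_mxM //.
  rewrite (DY _ Nn') (DY _ Nm).
  by rewrite mulmxA.
rewrite expr2 invfM; set S := \sum_(m in N) _.
have -> : d%:R * (#|N|%:R^-1 / #|N|%:R) * (#|N|%:R / d%:R * alpha * S) = alpha * (#|N|%:R^-1 * S).
  by field; rewrite nz_d neq0CG.
rewrite rpredM // Aint_coset_average ?rpredM ?cfConjC_char ?cfRepr_char //.
by rewrite /normal joing_subl join_subG normG cycle_subG.
Qed.

End Cocycle.

Lemma Aint_conj z : z \in Aint -> z^* \in Aint.
Proof. by move=> Zz; rewrite (Aint_aut Num.conj). Qed.

Lemma cyclic_extension_irr (gT : finGroupType) (N : {group gT}) (t : Iirr N) x :
    x \in 'I['chi_t] ->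
  exists (c : Iirr (N <*> <[x]>)) (rX : mx_representation algC (N <*> <[x]>) _),
    [/\ cfRepr rX = 'chi_c, {in N, rX =1 'Chi_t} & 'Res[N] 'chi_c = 'chi_t].
Proof.
move=> Ix; have nNx : x \in 'N(N) by case/setIdP: Ix.
have inv_x : {in N, forall n, 'chi_t (n ^ x)%g = 'chi_t n}.
  by move=> n _; apply: inertia_valJ.
have [rX DX] := cyclic_extension nNx inv_x (irrRepr t).
have ResX : 'Res[N] (cfRepr rX) = 'chi_t.
  apply/cfun_inP=> n Nn; have Hn := subsetP (joing_subl N <[x]>) n Nn.
  by rewrite cfResE ?joing_subl // -irrRepr !cfunE Nn Hn DX.
have /irrP[c Dc] : cfRepr rX \in irr (N <*> <[x]>)%G.
  by apply: (cfRes_irr_irr (H := N)); rewrite ?cfRepr_char ?ResX ?mem_irr.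
by exists c, rX; split; rewrite -?Dc.
Qed.

(** The factor 'chi_j(1) is an integer multiple of the degree of 'chi_t, which
absorbs the denominator d that Schur's lemma introduces in
[cocycle_integral]. *)
Lemma triple_integral (gT : finGroupType) (N K L : {group gT}) (t : Iirr N)
    (i i' : Iirr K) (j : Iirr L) x c :
    N <| K -> N \subset L -> L \subset K -> K \subset 'I['chi_t] ->
    t \in irr_constt ('Res[N] 'chi_i) -> t \in irr_constt ('Res[N] 'chi_i') ->
    t \in irr_constt ('Res[N] 'chi_j) -> x \in K -> c \in L ->
  'chi_j 1%g / #|N|%:R ^+ 2 * (\sum_(n in N) \sum_(m in N)
     'chi_i (x * n)%g * 'chi_i' (n^-1 * (x^-1 * c) * m)%g * ('chi_j (c * m)%g)^*) \in Aint.
Proof.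
move=> nsNK sNL sLK IKt iNt i'Nt jNt Kx Lc.
have [sNK nNK] := andP nsNK.
have Kc := subsetP sLK c Lc.
pose y := (x^-1 * c)%g; have Ky : y \in K by rewrite groupM ?groupV.
have Dc : c = (x * y)%g by rewrite mulKVg.
have Kxy : (x * y)%g \in K by rewrite -Dc.
have [cx [rX [DrX DX Nx]]] := cyclic_extension_irr (subsetP IKt x Kx).
have [cy [rY [DrY DY Ny]]] := cyclic_extension_irr (subsetP IKt y Ky).
have [cz [rZ [DrZ DZ Nz]]] := cyclic_extension_irr (subsetP IKt _ Kxy).
have nsNL : N <| L := normalS sNL sLK nsNK.
have [s Zs Ds] := invariant_coset_values nsNK IKt Kx Nx iNt.
have [s' Zs' Ds'] := invariant_coset_values nsNK IKt Ky Ny i'Nt.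
have Lxy : (x * y)%g \in L by rewrite -Dc.
have [s'' Zs'' Ds''] := invariant_coset_values nsNL (subset_trans sLK IKt) Lxy Nz jNt.
have [e De] := dvdn_constt_Res1_irr1 nsNL jNt.
have nNx := subsetP nNK x Kx; have nNy := subsetP nNK y Ky.
have Zco := cocycle_integral (irrRepr t) nNx nNy DX DY DZ.
have -> : \sum_(n in N) \sum_(m in N)
     'chi_i (x * n)%g * 'chi_i' (n^-1 * (x^-1 * c) * m)%g * ('chi_j (c * m)%g)^*
  = s * s' * s''^* * (\sum_(n in N) \sum_(m in N)
     cfRepr rX (x * n)%g * cfRepr rY (n^-1 * y * m)%g * (cfRepr rZ (x * y * m)%g)^*).
  rewrite mulr_sumr; apply: eq_bigr => n Nn.
  rewrite mulr_sumr; apply: eq_bigr => m Nm.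
  have -> : (n^-1 * (x^-1 * c) * m = y * ((n^-1) ^ y * m))%g.
    by rewrite -/y [RHS]mulgA -conjgC.
  have Nnm : ((n^-1) ^ y * m)%g \in N by rewrite groupM // memJ_norm ?groupV.
  rewrite Dc DrX DrY DrZ Ds // Ds' // Ds'' // rmorphM /=; ring.
rewrite De irr1_degree.
set S := \sum_(n in N) _ in Zco *.
have -> : e%:R * (irr_degree (socle_of_Iirr t))%:R / #|N|%:R ^+ 2 * (s * s' * s''^* * S)
  = e%:R * (s * s' * s''^*) * ((irr_degree (socle_of_Iirr t))%:R / #|N|%:R ^+ 2 * S) by ring.
apply: rpredM Zco; rewrite !rpredM ?rpred_nat //; exact: Aint_conj.
Qed.

(** * The Clifford correspondence *)

Lemma inertiaP (gT : finGroupType) (N : {group gT}) (phi : 'CF(N)) x :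
  reflect (x \in 'N(N) /\ {in N, forall n, phi (n ^ x)%g = phi n}) (x \in 'I[phi]).
Proof.
apply: (iffP idP) => [Ix | [nNx inv_x]].
  by split=> [|n _]; [case/setIdP: Ix | apply: inertia_valJ].
rewrite inE nNx; apply/eqP/cfun_inP=> n Nn; rewrite cfConjgE //.
by rewrite -inv_x ?conjgKV // memJ_norm ?groupV.
Qed.

Lemma constt_Res_cfclass (gT : finGroupType) (N K : {group gT}) (i : Iirr K) (t u : Iirr N) :
    N <| K -> t \in irr_constt ('Res[N] 'chi_i) ->
  (u \in irr_constt ('Res[N] 'chi_i)) = (u \in cfclass_Iirr K t).
Proof.
move=> nsNK iNt; rewrite cfclass_IirrE.
apply/idP/idP=> [|/cfclassP[x Kx Du]]; last first.
  by rewrite irr_consttE Du cfdot_Res_conjg.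
rewrite irr_consttE (Clifford_Res_sum_cfclass nsNK iNt) cfdotZl reindex_cfclass //.
apply: contraR => tN'u; rewrite cfdot_suml big1 ?mulr0 // => v tNv.
by rewrite cfdot_irr; case: eqP tNv => // ->; rewrite (negPf tN'u).
Qed.

Lemma cfdot_constt_eq0 (gT : finGroupType) (N K : {group gT}) (phi : 'CF(K))
    (i : Iirr K) (t : Iirr N) :
    phi \is a character -> t \in irr_constt ('Res[N] 'chi_i) ->
  '['Res[N] phi, 'chi_t] = 0 -> '[phi, 'chi_i] = 0.
Proof.
move=> Nphi iNt /eqP phiNt; apply/eqP; apply: contraLR phiNt => phi_i.
by rewrite -irr_consttE; apply: constt_Res_trans phi_i _ iNt.
Qed.

(** That the rest phi of the restriction of 'chi_i avoids 'chi_t is what turns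
multiplicities in restrictions of 'chi_i into multiplicities in restrictions of
its correspondent, with no error term. *)
Lemma Clifford_correspondent (gT : finGroupType) (N K T : {group gT}) (i : Iirr K) (t : Iirr N) :
    N <| K -> 'I_K['chi_t] = T -> t \in irr_constt ('Res[N] 'chi_i) ->
  exists (s : Iirr T) (phi : 'CF(T)),
    [/\ phi \is a character, 'Res[T] 'chi_i = 'chi_s + phi, 'chi_i = 'Ind 'chi_s,
        t \in irr_constt ('Res[N] 'chi_s) & '['Res[N] phi, 'chi_t] = 0].
Proof.
move=> nsNK defT iNt.
have -> : T = ('I_K['chi_t])%G by apply: group_inj.
have [irrA _ defB _ eqd] := constt_Inertia_bijection t nsNK.
have sNK := normal_sub nsNK.
have sTK : 'I_K['chi_t] \subset K := Inertia_sub _ _.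
have sNT : N \subset 'I_K['chi_t] := sub_Inertia _ sNK.
have : i \in irr_constt ('Ind[K] 'chi_t) by rewrite constt_Ind_Res.
rewrite -defB => /imsetP[s As Di].
have Dchi : 'chi_i = 'Ind 'chi_s by rewrite Di cfIirrE ?irrA.
have Ts : s \in irr_constt ('Res['I_K['chi_t]%G] 'chi_i).
  by rewrite -constt_Ind_Res -Dchi constt_irr inE.
have [|phi Nphi Dphi] := constt_charP s _ Ts; first by rewrite cfRes_char ?irr_char.
exists s, phi; split=> //; first by rewrite -constt_Ind_Res.
have /= := eqd s As; rewrite -Dchi -(cfResRes _ sNT sTK) Dphi linearD cfdotDl.
by rewrite -[X in X = _]addr0 => /addrI.
Qed.

(** * Fields of values *)

Lemma rational_in_subfield (K : {pred algC}) (a : rat) :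
  GRing.divring_closed K -> ratr a \in K.
Proof.
move=> closedK.
pose S : divringClosed algC :=
  HB.pack (K : {pred algC}) (GRing.isDivringClosed.Build algC K closedK).
rewrite -[K]/(S : {pred algC}) /ratr.
by rewrite rpred_div ?rpred_int.
Qed.

Lemma adjoin_in_subfield (Qn : splittingFieldType rat) (QnC : {rmorphism Qn -> algC})
    (K : {pred algC}) (rs : seq Qn) (E : {subfield Qn}) :
    GRing.divring_closed K -> {in E, forall a, QnC a \in K} ->
    {in rs, forall a, QnC a \in K} ->
  {in <<E & rs>>%VS, forall a, QnC a \in K}.
Proof.
move=> closedK.
pose S : divringClosed algC :=
  HB.pack (K : {pred algC}) (GRing.isDivringClosed.Build algC K closedK).
elim: rs E => [|x rs IHrs] E EK rsK a.
  by rewrite /= Fadjoin_nil; apply: EK.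
rewrite adjoin_cons; apply: IHrs => [b /Fadjoin_polyP[q Eq ->] | b rs_b]; last first.
  by rewrite rsK // inE rs_b orbT.
rewrite horner_coef rmorph_sum -[K]/(S : {pred algC}) rpred_sum // => i _.
rewrite rmorphM rmorphXn rpredM ?rpredX //; first exact: EK (polyOverP Eq i).
by apply: rsK; rewrite mem_head.
Qed.

(** All the values lie in a cyclotomic field.  Let L be its subfield generated by
the values of chi.  Galois automorphisms over L extend to algC and fix chi,
hence fix psi, so the values of psi lie in the fixed field, which is L.  The
order of H bounds the orders of the elements, hence the cyclotomic field. *)
Lemma subfield_of_values (gT gT1 gT2 : finGroupType) (H : {group gT})
    (G1 : {group gT1}) (G2 : {group gT2}) (chi : 'CF(G1)) (psi : 'CF(G2)) (K : {pred algC}) :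
    chi \is a character -> psi \is a character ->
    {in G1, forall x, (#[x] %| #|H|)%N} -> {in G2, forall x, (#[x] %| #|H|)%N} ->
    (forall u : {rmorphism algC -> algC}, cfAut u chi = chi -> cfAut u psi = psi) ->
    GRing.divring_closed K -> {in G1, forall x, chi x \in K} ->
  {in G2, forall y, psi y \in K}.
Proof.
move=> Nchi Npsi dvG1 dvG2 fix_psi closedK chiK y G2y.
have [Qn galQn [QnC gQnC [_ _ Qn_val]]] := group_num_field_exists H.
have [b Db] := Qn_val _ _ psi Npsi y (dvG2 y G2y).
have /fin_all_exists[a Da] (x : gT1) : exists a, x \in G1 -> QnC a = chi x.
  have [G1x | _] := boolP (x \in G1); last by exists 0.
  by have [a Da] := Qn_val _ _ chi Nchi x (dvG1 x G1x); exists a.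
pose rs := [seq a x | x <- enum G1].
pose L := <<1%AS & rs>>%AS.
rewrite -Db; apply: (adjoin_in_subfield (E := 1%AS) (rs := rs)) => //.
- by move=> c /vlineP[r ->]; rewrite alg_num_field fmorph_rat rational_in_subfield.
- by move=> c /mapP[x]; rewrite mem_enum => G1x ->; rewrite Da ?chiK.
have galL : galois L {:Qn} by apply: galoisS galQn; rewrite sub1v subvf.
rewrite -/L -(galois_fixedField galL); apply/fixedFieldP; first exact: memvf.
move=> nu Lnu; have [u Du] := gQnC nu.
apply: (fmorph_inj QnC); rewrite Du Db.
suffices /cfunP/(_ y): cfAut u psi = psi by rewrite cfunE.
apply: fix_psi; apply/cfun_inP=> x G1x; rewrite cfunE -Da // -Du.
by rewrite (fixed_gal _ Lnu) ?subvf // seqv_sub_adjoin // map_f ?mem_enum.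
Qed.

(** * Maximal ideals of the algebraic integers *)

Section MaximalIdeal.

Variables (p : nat) (M : {pred algC}).
Hypotheses (p_pr : prime p) (maxM : Aint_maximal_ideal M) (Mp : p%:R \in M).

Let MZ z : z \in M -> z \in Aint. Proof. by case: maxM => -[sub _ _ _] _ _; apply: sub. Qed.
Let M0 : 0 \in M. Proof. by case: maxM => -[]. Qed.
Lemma idealD x y : x \in M -> y \in M -> x + y \in M.
Proof. by case: maxM => -[_ _ add _] _ _; apply: add. Qed.
Lemma idealM a x : a \in Aint -> x \in M -> a * x \in M.
Proof. by case: maxM => -[_ _ _ mul] _ _; apply: mul. Qed.
Let M1 : 1 \notin M. Proof. by case: maxM. Qed.
Let MN x : x \in M -> - x \in M.
Proof. by move=> Mx; rewrite -mulN1r idealM // rpredN1. Qed.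
Lemma idealB x y : x \in M -> y \in M -> x - y \in M.
Proof. by move=> Mx My; rewrite idealD ?MN. Qed.

Lemma ideal_sum (I : Type) (r : seq I) (Q : pred I) (F : I -> algC) :
  (forall i, Q i -> F i \in M) -> \sum_(i <- r | Q i) F i \in M.
Proof. by move=> MF; apply: (big_ind [in M]) => //; apply: idealD. Qed.

Lemma ideal_eqAmod x y : (x == y %[mod p])%A -> x - y \in M.
Proof.
have nz_p : p%:R != 0 :> algC by rewrite pnatr_eq0 -lt0n prime_gt0.
rewrite /eqAmod unfold_in (negPf nz_p) => Zxy.
by rewrite -(divfK nz_p (x - y)) idealM.
Qed.

Lemma ideal_nat n : (n%:R \in M) = (p %| n)%N.
Proof.
apply/idP/idP=> [Mn | /dvdnP[k ->]]; last by rewrite natrM idealM ?rpred_nat.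
apply: contraLR M1; rewrite -prime_coprime // negbK => co_pn.
have [n0 | n_gt0] := posnP n.
  by move: co_pn; rewrite n0 /coprime gcdn0 => /eqP p1; rewrite -[1]/(1%:R) -p1.
case: (egcdnP p n_gt0) => u v def_uv _; rewrite gcdnC (eqP co_pn) in def_uv.
have -> : 1 = u%:R * n%:R - v%:R * p%:R :> algC by rewrite -!natrM def_uv natrD addrC addKr.
by rewrite idealB ?idealM ?rpred_nat.
Qed.

(** The ideal generated by M and x is proper unless 1 = m + b x, and then
y = m y + b (x y) lies in M. *)
Lemma ideal_prime x y :
  x \in Aint -> y \in Aint -> x * y \in M -> x \notin M -> y \in M.
Proof.
move=> Zx Zy Mxy notMx.
pose I : {pred algC} :=
  fun z => boolp.asbool (exists m b, [/\ m \in M, b \in Aint & z = m + b * x]).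
have IP z : reflect (exists m b, [/\ m \in M, b \in Aint & z = m + b * x]) (z \in I).
  exact: boolp.asboolP.
have idealI : Aint_ideal I.
  split.
  - by move=> z /IP[m [b [Mm Zb ->]]]; apply: rpredD; [exact: MZ | exact: rpredM].
  - by apply/IP; exists 0, 0; split=> //; rewrite mul0r addr0.
  - move=> z z' /IP[m [b [Mm Zb ->]]] /IP[m' [b' [Mm' Zb' ->]]].
    by apply/IP; exists (m + m'), (b + b'); split; rewrite ?idealD ?rpredD // mulrDl addrACA.
  move=> c z Zc /IP[m [b [Mm Zb ->]]]; apply/IP; exists (c * m), (c * b).
  by split; rewrite ?idealM ?rpredM // mulrDr mulrA.
have subMI : {subset M <= I}.
  by move=> z Mz; apply/IP; exists z, 0; split=> //; rewrite mul0r addr0.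
have Ix : x \in I by apply/IP; exists 0, 1; split=> //; rewrite mul1r add0r.
have /IP[m [b [Mm Zb D1]]] : 1 \in I.
  apply: contraNT notMx => notI1; case: maxM => _ _ /(_ I idealI subMI notI1).
  exact.
by rewrite -[y]mul1r D1 mulrDl idealD // ?[m * y]mulrC -?mulrA idealM.
Qed.

Lemma ideal_radical x n : x \in Aint -> x ^+ n.+1 \in M -> x \in M.
Proof.
move=> Zx; elim: n => [|n IHn]; first by rewrite expr1.
rewrite exprS => Mx; apply: contraT => notMx; case/negP: (notMx); apply: IHn.
by apply: (@ideal_prime x) => //; rewrite rpredX.
Qed.

(** Frobenius: (z - 1)^p and z^p - 1 differ by multiples of p, so that the claim
for z follows from that for z^p, as M is a radical ideal. *)
Lemma ideal_p_root z k : z ^+ (p ^ k) = 1 -> z - 1 \in M.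
Proof.
elim: k z => [|k IHk] z; first by rewrite expr1 => ->; rewrite subrr.
rewrite expnS exprM => zpk1; have Mzp := IHk _ zpk1.
have Zz : z \in Aint.
  apply: (@Aint_unity_root (p ^ k.+1)); first by rewrite expn_gt0 prime_gt0.
  by apply/unity_rootP; rewrite expnS exprM.
have [q Dp] : exists q, p = q.+1 by case: (p) p_pr => // q; exists q.
set y := z - 1; have Zy : y \in Aint by rewrite rpredB ?rpred1.
have Dz : z = 1 + y by rewrite addrC subrK.
apply: (@ideal_radical _ q) => //; rewrite -Dp.
suffices -> : y ^+ p = (z ^+ p - 1) - \sum_(i < q) y ^+ i.+1 *+ 'C(p, i.+1).
  rewrite idealB // ideal_sum // => i _; rewrite -mulr_natr idealM ?rpredX //.
  by rewrite ideal_nat prime_dvd_bin // ltnS /= Dp ltnS ltn_ord.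
have -> : z ^+ p = 1 + (\sum_(i < q) y ^+ i.+1 *+ 'C(p, i.+1) + y ^+ p).
  rewrite {1}Dz exprDn Dp big_ord_recl big_ord_recr /= expr1n mul1r bin0 mulr1n.
  rewrite /bump /= add1n binn mulr1n expr1n mul1r.
  by under eq_bigr do rewrite expr1n mul1r add1n.
by rewrite [1 + _]addrC addrK [_ + y ^+ p]addrC addrK.
Qed.

(** On the abelian group generated by z and u, phi is a sum of linear characters,
whose values at z are p-power roots of unity, that is, 1 modulo M. *)
Lemma char_p_part (gT : finGroupType) (G : {group gT}) (phi : 'CF(G)) z u :
    phi \is a character -> z \in G -> u \in G -> commute z u -> p.-elt z ->
  phi (z * u)%g - phi u \in M.
Proof.
move=> Nphi Gz Gu czu pz; pose A := (<[z]> <*> <[u]>)%G.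
have sAG : A \subset G by rewrite join_subG !cycle_subG Gz.
have [Az Au] : z \in A /\ u \in A by rewrite !mem_gen // inE cycle_id ?orbT.
have cAA : abelian A.
  have cuz : u \in 'C(<[z]>)%g by rewrite cent_cycle; apply/cent1P.
  by rewrite abelianY !cycle_abelian cycle_subG.
have Nphi_A := cfRes_char A Nphi.
rewrite -!(cfResE phi sAG) ?groupM // ['Res _]cfun_sum_constt !sum_cfunE -sumrB.
apply: ideal_sum => k _; rewrite !cfunE -mulrBr idealM //.
  by rewrite Aint_Cnat // Cnat_cfdot_char_irr.
have lin_k : 'chi_k \is a linear_char by apply/char_abelianP.
rewrite lin_charM // -[X in _ - X]mul1r -mulrBl mulrC idealM ?Aint_irr //.
have [e De] := p_natP pz; apply: (@ideal_p_root _ e).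
by rewrite -De lin_char_unity_root.
Qed.

End MaximalIdeal.

(** * The principal block *)

(** Class sums act as scalars in an irreducible representation. *)
Lemma class_sum_mul (gT : finGroupType) (G : {group gT}) (i : Iirr G) x w :
    x \in G -> w \in G ->
  \sum_(k in x ^: G) 'chi_i (k * w)%g = #|x ^: G|%:R * 'chi_i x / 'chi_i 1%g * 'chi_i w.
Proof.
move=> Gx Gw; pose D := 'Chi_i.
have KG k : k \in x ^: G -> k \in G by apply/subsetP; rewrite class_subG.
pose E := \sum_(k in x ^: G) D k.
have [e De] : exists e, E = e%:M.
  apply: (irr_comm_scalar (irrRepr i)) => g Gg; rewrite mulmx_suml mulmx_sumr.
  have actsK : [acts G, on x ^: G | 'J] by rewrite astabsJ class_norm.
  rewrite [LHS](reindex_acts _ actsK Gg) /=; apply: eq_bigr => k /KG Gk.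
  by rewrite -!repr_mxM ?groupJ // -conjgC.
have chiE k g : k \in G -> g \in G -> 'chi_i (k * g)%g = \tr (D k *m D g).
  by move=> Gk Gg; rewrite -irrRepr cfunE groupM // repr_mxM.
have -> : \sum_(k in x ^: G) 'chi_i (k * w)%g = \tr (E *m D w).
  by rewrite mulmx_suml raddf_sum; apply: eq_bigr => k /KG Gk; rewrite chiE.
have De1 : e * 'chi_i 1%g = #|x ^: G|%:R * 'chi_i x.
  rewrite irr1_degree mulr_natr -mxtrace_scalar -De raddf_sum mulr_natl -sumr_const /=.
  apply: eq_bigr => _ /imsetP[g Gg ->].
  by rewrite -(cfunJ 'chi_i x Gg) -irrRepr cfunE groupJ.
rewrite De mul_scalar_mx mxtraceZ -De1 mulfK ?irr1_neq0 //.
by rewrite -irrRepr cfunE Gw.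
Qed.

Section PrincipalBlock.

Variables (p : nat) (gT : finGroupType) (G S U : {group gT}).
Hypotheses (p_pr : prime p) (sylS : p.-Sylow(G) S).
Hypotheses (p'U : p^'.-group U) (defH : ('Z(S) * U = 'C_G(S))%g).

Let sSG : S \subset G := pHall_sub sylS.
Let pS : p.-group S := pHall_pgroup sylS.
Let sUH : U \subset 'C_G(S).
Proof. by rewrite -defH mulG_subr. Qed.
Let sUG : U \subset G := subset_trans sUH (subsetIl _ _).

(** In C_G(S) the p-part of z u is z when z is in Z(S) and u is in U, so a
p'-element has trivial component in Z(S). *)
Lemma p'elt_centralizer w : w \in 'C_G(S) -> p^'.-elt w -> w \in U.
Proof.
rewrite -defH => /mulsgP[z u Zz Uu ->] p'w.
have pz : p.-elt z := mem_p_elt (pgroupS (center_sub S) pS) Zz.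
have p'u : p^'.-elt u := mem_p_elt p'U Uu.
have czu : commute z u.
  have /setIP[_ cSu] := subsetP sUH u Uu.
  exact/commute_sym/(centP (subsetP (centS (center_sub S)) _ cSu)).
have := constt1P p'w; rewrite consttM // (constt1P p'u) mulg1 constt_p_elt // => ->.
by rewrite mul1g.
Qed.

Lemma sum_conj_fix (W : {set gT}) (F : gT -> algC) :
    W \subset G -> S \subset 'N(W) -> {in W, forall w, F w \in Aint} ->
    {in W & S, forall w s, F (w ^ s)%g = F w} ->
  (\sum_(w in W) F w == \sum_(w in W :&: 'C_G(S)) F w %[mod p])%A.
Proof.
move=> sWG nWS ZF invF.
have -> : \sum_(w in W :&: 'C_G(S)) F w = \sum_(w in W | w \in 'Fix_'J(S)) F w.
  apply: eq_bigl => w; rewrite afixJ in_setI in_setI; apply: andb_id2l => Ww.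
  by rewrite (subsetP sWG).
apply: pgroup_sum_fix => //; first exact: subsetT.
by move=> w s Ww Ss; rewrite /= memJ_norm // (subsetP nWS).
Qed.

Lemma class_card_mod x : x \in G -> (#|x ^: G| = #|x ^: G :&: 'C_G(S)| %[mod p])%N.
Proof.
move=> Gx; apply/eqP.
have nK : S \subset 'N(x ^: G) := subset_trans sSG (class_norm x G).
have sK : x ^: G \subset G by rewrite class_subG.
have := @sum_conj_fix (x ^: G) (fun _ => 1) sK nK (fun _ _ => rpred1 _) (fun _ _ _ _ => erefl).
by rewrite !sumr_const eqAmod_nat.
Qed.

Variable i : Iirr G.
Hypothesis p'chi : ~~ (p %| 'chi_i 1%g)%C.

(** Write K for a class and om(K) for the central character of 'chi_i on its class
sum, and let a be the sum of 'chi_i over U, which is a rational integer.  Let W be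
the union of the conjugates of U.  The sum of 'chi_i(k w) over k in K and w in W
is om(K) times the sum over W, which is a modulo p because conjugation by S fixes
exactly the elements of U in W.  Reducing k in K as well to C_G(S), k = z u0, and
ignoring the p-part z modulo M, the same sum is |K :&: C_G(S)| a.  Since that
cardinal is |K| modulo p, this gives a (om(K) - |K|) in M for every K.  If a is
not in M, then om(K) = |K| modulo M for every K.

Conversely, if 'chi_i lies in the principal block, then 'chi_i(u) = 'chi_i(1)
modulo M for u in U, as the class of u has length prime to p.  Hence a is
|U| 'chi_i(1) modulo M, and this integer is prime to p. *)
Lemma principal_blockP (M : {pred algC}) :
    Aint_maximal_ideal M -> p%:R \in M ->
  (forall k : 'I_#|classes G|, 'omega_i['K_k] - 'omega_(0 : Iirr G)['K_k] \in M)
    <-> ~~ (\sum_(u in U) 'chi_i u == 0 %[mod p])%A.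
Proof.
move=> maxM Mp.
have [n Dn] : exists n, 'chi_i 1%g = n%:R by apply/natrP/Cnat_irr1.
have p'n : ~~ (p %| n)%N by move: p'chi; rewrite Dn dvdC_nat.
pose a := \sum_(u in U) 'chi_i u.
have [m Da] : exists m, a = m%:R.
  have /natrP[m Dm] : '['Res[U] 'chi_i, 1] \in Num.nat.
    by rewrite Cnat_cfdot_char ?cfRes_char ?irr_char ?rpred1.
  exists (#|U| * m)%N; rewrite natrM -Dm cfdotE mulVKf ?neq0CG //.
  by apply: eq_bigr => u Uu; rewrite cfResE // cfun1E Uu conjC1 mulr1.
have omegaE (k : 'I_#|classes G|) (x : gT) : x \in enum_val k ->
    'omega_i['K_k] - 'omega_(0 : Iirr G)['K_k]
      = #|x ^: G|%:R * 'chi_i x / 'chi_i 1%g - #|x ^: G|%:R.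
  move=> kx; rewrite !(gring_mode_class_sum_eq _ kx) irr0 cfun11 divr1 cfun1E.
  have /imsetP[y Gy Dk] := enum_valP k.
  have -> : x \in G by move: kx; rewrite Dk; apply/subsetP; rewrite class_subG.
  by rewrite mulr1.
have Zchi g := Aint_irr i g.
have sUS u : u \in U -> S \subset 'C_G[u].
  move=> Uu; have /setIP[_ cSu] := subsetP sUH u Uu.
  by rewrite subsetI sSG sub_cent1.
rewrite -/a Da eqAmod0_nat; split=> [block | p'm k].
  apply/negP=> dv_m.
  have chiU u : u \in U -> 'chi_i u - 'chi_i 1%g \in M.
    move=> Uu; have Gu := subsetP sUG u Uu.
    have KG := mem_classes Gu; pose k := enum_rank_in KG (u ^: G).
    have k_u : u \in enum_val k by rewrite enum_rankK_in // class_refl.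
    have := idealM maxM (Zchi 1%g) (block k); rewrite (omegaE k u k_u).
    have -> : 'chi_i 1%g * (#|u ^: G|%:R * 'chi_i u / 'chi_i 1%g - #|u ^: G|%:R)
            = #|u ^: G|%:R * ('chi_i u - 'chi_i 1%g) by field; rewrite irr1_neq0.
    move/(ideal_prime maxM); apply; rewrite ?rpred_nat ?rpredB //.
    rewrite (ideal_nat p_pr maxM Mp) -index_cent1 -p'natE //.
    by apply: pnat_dvd (indexgS G (sUS u Uu)) _; case/and3P: sylS.
  have : a - #|U|%:R * 'chi_i 1%g \in M.
    rewrite mulr_natl -sumr_const -sumrB (ideal_sum maxM) // => u Uu; exact: chiU.
  have Ma : a \in M by rewrite Da (ideal_nat p_pr maxM Mp).
  move/(idealB maxM Ma); rewrite opprB addrCA subrr addr0 Dn -natrM (ideal_nat p_pr maxM Mp).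
  by rewrite Euclid_dvdM // (negPf p'n) orbF; apply/negP; rewrite -p'natE.
have /imsetP[x Gx Dk] := enum_valP k.
rewrite (omegaE k x) ?Dk ?class_refl //.
set om := _ / _; pose K := x ^: G.
pose W := class_support U G.
have KG : K \subset G by rewrite class_subG.
have WG : W \subset G by rewrite class_support_subG.
have nKS : S \subset 'N(K) := subset_trans sSG (class_norm x G).
have nWS : S \subset 'N(W) := subset_trans sSG (class_support_norm U G).
have defWH : W :&: 'C_G(S) = U.
  apply/setP=> w; apply/setIP/idP=> [[/imset2P[u g Uu Gg ->] Hw] | Uw].
    by apply: p'elt_centralizer; rewrite ?p_eltJ ?(mem_p_elt p'U).
  split; last exact: subsetP sUH w Uw.
  by apply/imset2P; exists w 1%g; rewrite ?conjg1.
pose f g := \sum_(w in W) 'chi_i (g * w)%g.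
have Zf g : f g \in Aint by apply: rpred_sum.
have Zom : om \in Aint by apply: Aint_class_div_irr1.
have sum_f : \sum_(g in K) f g = om * \sum_(w in W) 'chi_i w.
  rewrite exchange_big mulr_sumr; apply: eq_bigr => w Ww.
  by rewrite class_sum_mul // (subsetP WG).
have invf : {in K & S, forall g s, f (g ^ s)%g = f g}.
  move=> g s Kg Ss; have Gs := subsetP sSG s Ss.
  have actsW : [acts S, on W | 'J] by rewrite astabsJ.
  rewrite /f (reindex_acts _ actsW Ss) /=; apply: eq_bigr => w _.
  by rewrite -conjMg cfunJ.
have eq_f : (\sum_(g in K) f g == \sum_(g in K :&: 'C_G(S)) f g %[mod p])%A.
  exact: sum_conj_fix.
have eq_W : (\sum_(w in W) 'chi_i w == a %[mod p])%A.
  rewrite /a -defWH; apply: sum_conj_fix => // w s Ww Ss.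
  by rewrite cfunJ // (subsetP sSG).
have f_a g : g \in 'C_G(S) -> f g - a \in M.
  move=> Hg; have /setIP[Gg cSg] := Hg.
  have eq_fg : (f g == \sum_(u in U) 'chi_i (g * u)%g %[mod p])%A.
    rewrite -defWH; apply: sum_conj_fix => // w s Ww Ss.
    have Gs := subsetP sSG s Ss.
    have gs : (g ^ s = g)%g by rewrite conjgE (centP cSg s Ss) mulKg.
    by rewrite -{1}gs -conjMg cfunJ.
  move: Hg; rewrite -defH => /mulsgP[z u0 Zz Uu0 Dg].
  have -> : f g - a = (f g - \sum_(u in U) 'chi_i (g * u)%g)
                      + \sum_(u in U) ('chi_i (z * (u0 * u))%g - 'chi_i (u0 * u)%g).
    rewrite sumrB -addrA; congr (_ + _); rewrite addrA.
    have -> : \sum_(u in U) 'chi_i (g * u)%g = \sum_(u in U) 'chi_i (z * (u0 * u))%g.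
      by apply: eq_bigr => u _; rewrite Dg mulgA.
    rewrite addNr add0r /a; congr (- _); rewrite [LHS](reindex_inj (mulgI u0)).
    by apply: eq_bigl => u; rewrite groupMl.
  apply: (idealD maxM); first exact: (ideal_eqAmod p_pr maxM Mp).
  apply: (ideal_sum maxM) => u Uu; have Uu0u : (u0 * u)%g \in U by rewrite groupM.
  have Sz : z \in S := subsetP (center_sub S) z Zz.
  have [Gz Gu] := (subsetP sSG z Sz, subsetP sUG _ Uu0u).
  apply: (char_p_part p_pr maxM Mp (irr_char i) Gz Gu); last exact: mem_p_elt pS Sz.
  by have /setIP[_ cSu] := subsetP sUH _ Uu0u; apply: commute_sym; apply: (centP cSu).
have eqK : (#|K|%:R == #|K :&: 'C_G(S)|%:R %[mod p])%A.
  by rewrite eqAmod_nat; apply/eqP/class_card_mod.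
have notMm : m%:R \notin M by rewrite (ideal_nat p_pr maxM Mp).
have Za : a \in Aint by rewrite Da rpred_nat.
apply: (ideal_prime maxM) notMm; rewrite ?rpred_nat ?rpredB ?rpred_nat // -Da.
have -> : a * (om - #|K|%:R) = (om * a - om * \sum_(w in W) 'chi_i w)
   + (\sum_(g in K) f g - \sum_(g in K :&: 'C_G(S)) f g)
   + \sum_(g in K :&: 'C_G(S)) (f g - a) + (#|K :&: 'C_G(S)|%:R * a - #|K|%:R * a).
  by rewrite sum_f sumrB sumr_const -mulr_natl; ring.
have ML := ideal_eqAmod p_pr maxM Mp.
apply: (idealD maxM); last first.
  by apply: ML; apply: eqAmodMr => //; rewrite eqAmod_sym.
apply: (idealD maxM).
  apply: (idealD maxM); last exact: ML.
  by apply: ML; apply: eqAmodMl => //; rewrite eqAmod_sym.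
by apply: (ideal_sum maxM) => g /setIP[_ Hg]; apply: f_a.
Qed.

End PrincipalBlock.

(** * Cosets fixed by P *)

Section RelativeGlauberman.

Variables (p : nat) (aT gT : finGroupType) (P : {group aT}) (G N C : {group gT}).
Variable to : groupAction P G.
Hypotheses (p_pr : prime p) (pP : p.-group P) (nsNG : N <| G).
Hypotheses (nNP : [acts P, on N | to]) (sNC : N \subset C) (sCG : C \subset G).
Hypothesis defC : (C / N)%g = 'C_(|to / N)(P)%g.
Hypothesis p'GN : p^'.-group (G / N)%g.

Let sNG : N \subset G := normal_sub nsNG.
Let nNG : G \subset 'N(N) := normal_norm nsNG.
Let nsNC : N <| C := normalS sNC sCG nsNG.
Let nGP : [acts P, on G | to] := proj1 (gacts_range to (subxx P)).

Lemma sub_qact_dom : P \subset qact_dom to N.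
Proof. by rewrite qact_domE. Qed.

Lemma qact_coset x a :
  x \in G -> a \in P -> (to / N)%act (coset N x) a = coset N (to x a).
Proof. by move=> Gx Pa; rewrite qactE ?(subsetP nNG) ?(subsetP sub_qact_dom). Qed.

Lemma mem_fixC x : x \in G -> (x \in C) = (coset N x \in 'Fix_(to / N)(P)).
Proof.
move=> Gx; have nNx := subsetP nNG x Gx.
have ->: (x \in C) = (x \in coset N @*^-1 (C / N))%g by rewrite quotientGK.
rewrite morphpreE in_setI nNx inE /= defC gacentE ?sub_qact_dom //.
by rewrite inE mem_quotient.
Qed.

Lemma coset_fixC x a : x \in C -> a \in P -> coset N (to x a) = coset N x.
Proof.
move=> Cx Pa; have Gx := subsetP sCG x Cx.
by have:= Cx; rewrite mem_fixC // => /afixP/(_ a Pa); rewrite qact_coset.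
Qed.

Lemma fixed_memC x : x \in G -> {in P, forall a, to x a = x} -> x \in C.
Proof.
move=> Gx fix_x; rewrite mem_fixC //; apply/afixP=> a Pa.
by rewrite qact_coset // fix_x.
Qed.

(** The action of P moves an element of C only within its coset of N. *)
Lemma acts_between (K : {group gT}) :
    N \subset K -> K \subset C -> [acts P, on K | to].
Proof.
move=> sNK sKC; apply/subsetP=> a Pa; rewrite !inE Pa.
apply/subsetP=> x Kx; have Cx := subsetP sKC x Kx; have Gx := subsetP sCG x Cx.
have Gxa : to x a \in G by rewrite (gact_stable to Pa).
rewrite inE.
have /rcosetP[n Nn ->]: to x a \in N :* x.
  by apply/rcoset_kercosetP; rewrite ?(subsetP nNG) // coset_fixC.
by rewrite groupM // (subsetP sNK).
Qed.

Let nCP : [acts P, on C | to] := acts_between sNC (subxx C).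

(** Both sides are sums of F A over cosets A, where F A is the sum of f over A
divided by |N|.  As f is P-invariant, so is F, and only the fixed cosets count
modulo p. *)
Lemma coset_sum_fixC (K : {group gT}) (f : gT -> algC) :
    N \subset K -> K \subset G -> [acts P, on K | to] ->
    {in P & K, forall a x, f (to x a) = f x} ->
    {in K, forall x, #|N|%:R^-1 * (\sum_(n in N) f (x * n)%g) \in Aint} ->
  (#|N|%:R^-1 * (\sum_(x in K) f x) == #|N|%:R^-1 * (\sum_(x in K :&: C) f x) %[mod p])%A.
Proof.
move=> sNK sKG nKP invf Zf.
pose F A := #|N|%:R^-1 * (\sum_(x in K | coset N x == A) f x).
have FE x : x \in K -> F (coset N x) = #|N|%:R^-1 * (\sum_(n in N) f (x * n)%g).
  by move=> Kx; congr (_ * _); apply: sum_coset_mulr; rewrite ?(normalS sNK sKG).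
have -> : #|N|%:R^-1 * (\sum_(x in K) f x) = \sum_(A in (K / N)%g) F A.
  rewrite (partition_big (coset N) [in (K / N)%g]) /= ?mulr_sumr // => x Kx.
  exact: mem_quotient.
have -> : #|N|%:R^-1 * (\sum_(x in K :&: C) f x)
            = \sum_(A in (K / N)%g | A \in 'Fix_(to / N)(P)) F A.
  rewrite (partition_big (coset N) (fun A => (A \in (K / N)%g) && (A \in 'Fix_(to / N)(P)))) /=.
    rewrite mulr_sumr; apply: eq_bigr => A /andP[_ fixA]; congr (_ * _).
    apply: eq_bigl => x; rewrite inE; apply/andP/andP=> [[/andP[-> _] ->] // | [Kx /eqP DA]].
    by rewrite Kx DA mem_fixC ?(subsetP sKG) // DA fixA.
  move=> x /setIP[Kx Cx]; rewrite mem_quotient //= -mem_fixC //.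
  exact: subsetP sCG x Cx.
apply: pgroup_sum_fix sub_qact_dom _ _ _ => //.
- move=> _ a /morphimP[x nNx Kx ->] Pa.
  rewrite qact_coset ?(subsetP sKG) // mem_quotient //.
  by rewrite (acts_act nKP).
- by move=> _ /morphimP[x nNx Kx ->]; rewrite FE ?Zf.
move=> _ a /morphimP[x nNx Kx ->] Pa; rewrite qact_coset ?(subsetP sKG) //.
congr (_ * _).
rewrite (reindex_inj (act_inj to a)); apply: eq_big => [y | y /andP[Ky _]].
  rewrite (acts_act nKP) //; apply: andb_id2l => Ky.
  rewrite -!qact_coset ?(subsetP sKG) //; exact: (inj_eq (act_inj _ _)).
by move: Ky; rewrite (acts_act nKP) // => Ky; apply: invf.
Qed.

Lemma coprime_quotient (L : {group gT}) : L \subset G -> coprime p #|(L / N)%g|.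
Proof.
move=> sLG; rewrite prime_coprime // -p'natE //.
exact: pgroupS (quotientS _ sLG) p'GN.
Qed.

(** * Each psi is linked to at most one chi *)

(** The sum over x in K of f x is a pairing of the convolution of 'chi_i and
'chi_i' with 'chi_j, and vanishes because these characters are distinct.  The sum
over x in L evaluates by [convolution_irr] to the product of multiplicities times
|L : N|^2, once divided by |N|. *)
Lemma invariant_column (K L : {group gT}) (t : Iirr N) (i i' : Iirr K) (j : Iirr L) :
    K :&: C = L ->
    N \subset K -> K \subset G -> [acts P, on K | to] -> K \subset 'I['chi_t] ->
    i \in invIirr to K -> i' \in invIirr to K -> j \in invIirr to L ->
    t \in irr_constt ('Res[N] 'chi_i) -> t \in irr_constt ('Res[N] 'chi_i') ->
    t \in irr_constt ('Res[N] 'chi_j) -> i != i' ->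
  ('['Res[L] 'chi_i, 'chi_j] * '['Res[L] 'chi_i', 'chi_j] == 0 %[mod p])%A.
Proof.
move=> defL sNK sKG nKP IKt inv_i inv_i' inv_j iNt i'Nt jNt /negPf ne_ii'.
have nsNK : N <| K := normalS sNK sKG nsNG.
have sLK : L \subset K by rewrite -defL subsetIl.
have sNL : N \subset L by rewrite -defL subsetI sNK.
have sLC : L \subset C by rewrite -defL subsetIr.
have nLP : [acts P, on L | to] := acts_between sNL sLC.
have nsNL : N <| L := normalS sNL sLK nsNK.
have sLG := subset_trans sLC sCG.
(* The factor 'chi_j(1) is what makes the coset averages integral, and it *)
(* cancels the denominator in the formula for the convolution. *)
pose T x := \sum_(c in L) 'chi_i' (x^-1 * c)%g * ('chi_j c)^*.
pose f x := 'chi_j 1%g / #|N|%:R * ('chi_i x * T x).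
have invf : {in P & K, forall a x, f (to x a) = f x}.
  move=> a x Pa Kx; congr (_ * (_ * _)); first by move/invIirrP: inv_i => ->.
  rewrite /T -(sum_act nLP _ Pa); apply: eq_bigr => c Lc.
  have Kc := subsetP sLK c Lc; have [Gx Gc] := (subsetP sKG x Kx, subsetP sKG c Kc).
  have -> : ((to x a)^-1 * to c a = to (x^-1 * c) a)%g by rewrite gactM ?groupV // gactV.
  rewrite (invIirrP _ _ inv_j) // (invIirrP _ _ inv_i') //.
  by rewrite groupM ?groupV.
have Zf : {in K, forall x, #|N|%:R^-1 * (\sum_(n in N) f (x * n)%g) \in Aint}.
  move=> x Kx.
  have -> : #|N|%:R^-1 * (\sum_(n in N) f (x * n)%g)
    = \sum_(A in (L / N)%g) 'chi_j 1%g / #|N|%:R ^+ 2 * (\sum_(n in N) \sum_(m in N)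
       'chi_i (x * n)%g * 'chi_i' (n^-1 * (x^-1 * repr A) * m)%g * ('chi_j (repr A * m)%g)^*).
    rewrite -[RHS]mulr_sumr exchange_big /= -mulr_sumr mulrA; congr (_ * _).
      by field; rewrite neq0CG.
    apply: eq_bigr => n _; rewrite /T (sum_cosets _ nsNL) mulr_sumr.
    apply: eq_bigr => A _; rewrite mulr_sumr; apply: eq_bigr => m _.
    by rewrite invMg !mulgA mulrA.
  rewrite rpred_sum // => A LA; apply: (triple_integral (t := t)) => //.
  have [c nNc Lc ->] := morphimP LA.
  have: repr (coset N c) \in N :* c by rewrite -val_coset // mem_repr_coset.
  by case/rcosetP=> n Nn ->; rewrite groupM // (subsetP sNL).
have sumT (H : {group gT}) : #|N|%:R^-1 * (\sum_(x in H) f x)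
    = 'chi_j 1%g / #|N|%:R ^+ 2 *
      (\sum_(c in L) (\sum_(x in H) 'chi_i x * 'chi_i' (x^-1 * c)%g) * ('chi_j c)^*).
  rewrite -mulr_sumr mulrA; congr (_ * _); first by field; rewrite neq0CG.
  under [RHS]eq_bigr do rewrite mulr_suml.
  rewrite exchange_big; apply: eq_bigr => x _; rewrite /T mulr_sumr.
  by apply: eq_bigr => c _; rewrite mulrA.
have := coset_sum_fixC sNK sKG nKP invf Zf; rewrite defL !sumT.
rewrite [X in (X == _ %[mod _])%A](_ : _ = 0); last first.
  rewrite big1 ?mulr0 // => c Lc.
  have := generalized_orthogonality_relation c i' i; rewrite eq_sym ne_ii' mul0r.
  move/eqP; rewrite mulf_eq0 invr_eq0 (negPf (neq0CG K)) /= => /eqP sum0.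
  rewrite (reindex_inj invg_inj) /= [X in X * _](_ : _ = 0) ?mul0r // -[RHS]sum0.
  apply: eq_big => x; first by rewrite groupV.
  by rewrite invgK mulrC.
have -> : \sum_(c in L) (\sum_(x in L) 'chi_i x * 'chi_i' (x^-1 * c)%g) * ('chi_j c)^*
   = '['Res[L] 'chi_i, 'chi_j] * '['Res[L] 'chi_i', 'chi_j] * (#|L|%:R ^+ 2 / 'chi_j 1%g).
  rewrite -convolution_irr; apply: eq_bigr => c Lc; congr (_ * _).
  by apply: eq_bigr => x Lx; rewrite !cfResE ?groupM ?groupV.
set b := '[_, _] * _.
have Zb : b \in Aint by rewrite rpredM // Aint_Cnat // Cnat_cfdot_char_irr // cfRes_char ?irr_char.
have -> : 'chi_j 1%g / #|N|%:R ^+ 2 * (b * (#|L|%:R ^+ 2 / 'chi_j 1%g))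
        = b * (#|(L / N)%g| ^ 2)%N%:R.
  rewrite card_quotient ?normal_norm // natrX -[#|L|](Lagrange sNL) natrM.
  by field; rewrite irr1_neq0 neq0CG.
rewrite eqAmod_sym; apply: eqAmod0_mulIn; rewrite ?prime_gt0 //.
by rewrite coprimeXr // coprime_quotient.
Qed.

Lemma Res_twist (K H : {group gT}) (i : Iirr K) a :
    H \subset K -> [acts P, on H | to] -> i \in invIirr to K -> a \in P ->
  {in H, forall x, ('Res[H] 'chi_i) x = ('Res[H] 'chi_i) (to x a)}.
Proof.
move=> sHK nHP inv_i Pa x Hx; have Kx := subsetP sHK x Hx.
by rewrite !cfResE ?(act_memE nHP) // (invIirrP _ _ inv_i).
Qed.

Lemma cfdot_irr_twist (H : {group gT}) (phi : 'CF(H)) (i j : Iirr H) a :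
    [acts P, on H | to] -> a \in P ->
    {in H, forall x, phi x = phi (to x a)} ->
    {in H, forall x, 'chi_j x = 'chi_i (to x a)} ->
  '[phi, 'chi_j] = '[phi, 'chi_i].
Proof. by move=> nHP Pa inv_phi Dj; apply: (cfdot_twist nHP Pa). Qed.

Lemma acts_inertia (K : {group gT}) (t : Iirr N) :
    K \subset G -> [acts P, on K | to] -> t \in invIirr to N ->
  [acts P, on 'I_K['chi_t] | to].
Proof.
move=> sKG nKP inv_t; apply/subsetP=> a Pa; rewrite !inE Pa; apply/subsetP=> x.
case/setIP=> Kx Ix; have Gx := subsetP sKG x Kx.
rewrite inE in_setI (act_memE nKP) // Kx; apply/inertiaP; split.
  by rewrite (subsetP nNG) // (gact_stable to Pa).
move=> m Nm; have Nn : to m a^-1%g \in N by rewrite (act_memE nNP) ?groupV.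
have Gn := subsetP sNG _ Nn; have nNx := subsetP nNG x Gx.
rewrite -(actKVin to Pa m) -gactJ // (invIirrP _ _ inv_t) ?memJ_norm // actKVin //.
  by case/inertiaP: Ix => _ ->; rewrite ?(invIirrP _ _ inv_t) ?groupV.
Qed.

(** The constituents of the restriction to N form one K-orbit, whose length is an
index of a group containing N, hence prime to p.  So P fixes one of them. *)
Lemma invariant_constt_exists (K : {group gT}) (j : Iirr K) :
    N \subset K -> K \subset G -> [acts P, on K | to] -> j \in invIirr to K ->
  exists2 t, t \in invIirr to N & t \in irr_constt ('Res[N] 'chi_j).
Proof.
move=> sNK sKG nKP inv_j; have nsNK : N <| K := normalS sNK sKG nsNG.
apply/exists_inP; apply: contraLR (coprime_quotient sKG) => /exists_inPn no_t.
rewrite prime_coprime // negbK card_quotient ?normal_norm //.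
pose F (t : Iirr N) : algC := (t \in irr_constt ('Res[N] 'chi_j))%:R.
have := @sum_invIirr _ _ _ _ to N sNG nNP p F p_pr pP.
rewrite [\sum_(t in _) _]big1 => [|t inv_t]; last by rewrite /F (negPf (no_t t inv_t)).
have [t0 jNt0] := neq0_has_constt (Res_irr_neq0 N j).
have -> : \sum_t F t = #|K : 'I_K['chi_t0]|%:R.
  rewrite -card_cfclass_Iirr // -sum1_card natr_sum [RHS]big_mkcond.
  by apply: eq_bigr => t _; rewrite /F (constt_Res_cfclass _ nsNK jNt0); case: ifP.
rewrite eqAmod0_nat => dv_p; apply: dvdn_trans (indexgS K (sub_Inertia 'chi_t0 sNK)).
apply: dv_p => [t|a t u Pa Du]; rewrite /F ?rpred_nat // !irr_consttE.
by rewrite (cfdot_irr_twist nNP Pa (Res_twist sNK nNP inv_j Pa) Du).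
Qed.

(** The conjugates of 'chi_s by P have the same properties as 'chi_s, and 'chi_s
is the only constituent of the restriction of 'chi_i that lies over 'chi_t. *)
Lemma correspondent_inv (K T : {group gT}) (i : Iirr K) (t : Iirr N) (s : Iirr T)
    (phi : 'CF(T)) :
    N \subset T -> T \subset K -> T \subset G -> [acts P, on T | to] ->
    i \in invIirr to K -> t \in invIirr to N ->
    phi \is a character -> 'Res[T] 'chi_i = 'chi_s + phi ->
    t \in irr_constt ('Res[N] 'chi_s) -> '['Res[N] phi, 'chi_t] = 0 ->
  s \in invIirr to T.
Proof.
move=> sNT sTK sTG nTP inv_i inv_t Nphi Dphi sNt phiNt.
apply/invIirrP=> a x Pa Tx.
have [s' /'forall_in_eqP Ds'] := twist_irr_exists sTG nTP s Pa.
suffices Es : s' = s by rewrite -Ds' // Es.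
have s'Nt : t \in irr_constt ('Res[N] 'chi_s').
  rewrite irr_consttE (_ : '[_, _] = '['Res[N] 'chi_s, 'chi_t]) //.
  apply: (cfdot_twist nNP Pa) => n Nn; last by rewrite (invIirrP _ _ inv_t).
  by have Tn := subsetP sNT n Nn; rewrite !cfResE ?(act_memE nNP) ?Ds'.
have := cfdot_irr_twist nTP Pa (Res_twist sTK nTP inv_i Pa) Ds'.
rewrite Dphi !cfdotDl (cfdot_constt_eq0 Nphi s'Nt) // (cfdot_constt_eq0 Nphi sNt) //.
rewrite !addr0 !cfdot_irr eqxx; case: eqP => // _ /esym/eqP.
by rewrite oner_eq0.
Qed.

(** Unless one of the multiplicities is 0, all three characters lie over a
P-invariant 'chi_t.  Replacing them by their Clifford correspondents over 'chi_t
keeps the multiplicities and gives the situation of [invariant_column]. *)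
Lemma column_uniqueness (i i' : Iirr G) (j : Iirr C) :
    i \in invIirr to G -> i' \in invIirr to G -> j \in invIirr to C -> i != i' ->
  ('['Res[C] 'chi_i, 'chi_j] * '['Res[C] 'chi_i', 'chi_j] == 0 %[mod p])%A.
Proof.
move=> inv_i inv_i' inv_j ne_ii'.
have [ij0 | i_j] := eqVneq '['Res[C] 'chi_i, 'chi_j] 0; first by rewrite ij0 mul0r.
have [i'j0 | i'_j] := eqVneq '['Res[C] 'chi_i', 'chi_j] 0; first by rewrite i'j0 mulr0.
have [t inv_t jNt] := invariant_constt_exists sNC sCG nCP inv_j.
have over_t k : '['Res[C] 'chi_k, 'chi_j] != 0 -> t \in irr_constt ('Res[N, G] 'chi_k).
  move=> k_j; have := constt_Res_trans (cfRes_char C (irr_char k)) k_j jNt.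
  by rewrite cfResRes.
pose T := ('I_G['chi_t])%G; pose L := ('I_C['chi_t])%G.
have [s [phi [Nphi Dphi Di sNt phiNt]]] :=
  Clifford_correspondent nsNG (erefl (gval T)) (over_t i i_j).
have [s' [phi' [Nphi' Dphi' Di' s'Nt phi'Nt]]] :=
  Clifford_correspondent nsNG (erefl (gval T)) (over_t i' i'_j).
have [r [psi [Npsi Dpsi Dj rNt psiNt]]] := Clifford_correspondent nsNC (erefl (gval L)) jNt.
have sNT : N \subset T := sub_Inertia _ sNG.
have sTG : T \subset G := Inertia_sub _ _.
have sNL : N \subset L := sub_Inertia _ sNC.
have sLC : L \subset C := Inertia_sub _ _.
have sLT : L \subset T by rewrite setSI.
have nTP : [acts P, on T | to] := acts_inertia (subxx G) nGP inv_t.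
have nLP : [acts P, on L | to] := acts_inertia sCG nCP inv_t.
have dotE k u om : om \is a character -> 'Res[T] 'chi_k = 'chi_u + om ->
    '['Res[N] om, 'chi_t] = 0 -> '['Res[C, G] 'chi_k, 'chi_j] = '['Res[L] 'chi_u, 'chi_r].
  move=> Nom Dom omNt; rewrite Dj -cfdot_Res_l cfResRes // -(cfResRes _ sLT sTG) Dom.
  rewrite linearD cfdotDl (cfdot_constt_eq0 (cfRes_char _ Nom) rNt) ?addr0 //.
  by rewrite cfResRes.
rewrite (dotE i s phi) // (dotE i' s' phi') //.
apply: (invariant_column (t := t)) => //.
- by rewrite setIAC (setIidPr sCG).
- exact: subsetIr.
- exact: correspondent_inv Dphi sNt phiNt.
- exact: correspondent_inv Dphi' s'Nt phi'Nt.
- exact: (correspondent_inv sNL sLC (subset_trans sLC sCG)) Dpsi rNt psiNt.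
by apply: contra_neq ne_ii' => ss'; apply: irr_inj; rewrite Di Di' ss'.
Qed.

(** * Characters over invariant characters *)

(** There are |H : N| extensions of 'chi_t to H = N <*> <[x]>, a number prime to
p, so that P fixes one of them.  The others differ from it by linear characters
of H / N, on which P acts trivially as H lies in C. *)
Lemma extension_inv (t : Iirr N) x :
    t \in invIirr to N -> x \in C -> x \in 'I['chi_t] ->
  {in irr_constt ('Ind[N <*> <[x]>] 'chi_t), forall u, u \in invIirr to (N <*> <[x]>)}.
Proof.
move=> inv_t Cx Ix; pose H := (N <*> <[x]>)%G.
have Gx := subsetP sCG x Cx; have nNx := subsetP nNG x Gx.
have sHC : H \subset C by rewrite join_subG sNC cycle_subG.
have sNH : N \subset H := joing_subl _ _.
have sHG := subset_trans sHC sCG.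
have nsNH : N <| H := normalS sNH sHG nsNG.
have nHP := acts_between sNH sHC.
have [c [_ [_ _ Nc]]] := cyclic_extension_irr Ix.
have cycHN : cyclic (H / N) by rewrite quotientYidl ?cycle_subG // quotient_cyclic ?cycle_cyclic.
have linHN (b : Iirr (H / N)) : 'chi_b 1%g = 1 by apply/eqP; have /andP[] := irr_cyclic_lin b cycHN.
have [irr_mul inj_mul constt_t _] := constt_Ind_ext nsNH Nc.
have mulE b y : y \in H -> 'chi_(mul_mod_Iirr c b) y = 'chi_b (coset N y) * 'chi_c y.
  by move=> Hy; rewrite cfIirrE ?irr_mul // cfunE mod_IirrE // cfModE.
have [u0 inv_u0 tHu0] : exists2 u0, u0 \in invIirr to H & u0 \in irr_constt ('Ind[H] 'chi_t).
  apply/exists_inP; apply: contraLR (coprime_quotient sHG) => /exists_inPn no_u.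
  rewrite prime_coprime // negbK.
  pose F (u : Iirr H) : algC := (u \in irr_constt ('Ind[H] 'chi_t))%:R.
  have := @sum_invIirr _ _ _ _ to H sHG nHP p F p_pr pP.
  rewrite [\sum_(u in _) _]big1 => [|u inv_u]; last by rewrite /F (negPf (no_u u inv_u)).
  have -> : \sum_u F u = #|(H / N)%g|%:R.
    rewrite -(card_Iirr_cyclic cycHN) -(card_codom inj_mul) -sum1_card natr_sum [RHS]big_mkcond.
    by apply: eq_bigr => u _; rewrite /F constt_t; case: ifP.
  rewrite eqAmod0_nat; apply=> [u|a u v Pa Dv]; rewrite /F ?rpred_nat //.
  rewrite !constt_Ind_Res !irr_consttE (_ : '['Res 'chi_v, _] = '['Res 'chi_u, 'chi_t]) //.
  apply: (cfdot_twist nNP Pa) => n Nn; last by rewrite (invIirrP _ _ inv_t).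
  by have Hn := subsetP sNH n Nn; rewrite !cfResE ?(act_memE nNP) ?Dv.
have Nu0 : 'Res[N] 'chi_u0 = 'chi_t.
  have:= tHu0; rewrite constt_t => /codomP[b Db]; apply/cfun_inP=> n Nn.
  have Hn := subsetP sNH n Nn.
  by rewrite -Nc !cfResE // Db mulE // coset_id // linHN mul1r.
have [irr_mul0 _ constt0 _] := constt_Ind_ext nsNH Nu0.
move=> u; rewrite constt0 => /codomP[b ->]; apply/invIirrP=> a y Pa Hy.
have Hya : to y a \in H by rewrite (act_memE nHP).
rewrite cfIirrE ?irr_mul0 // !cfunE mod_IirrE // !cfModE //.
by rewrite (invIirrP _ _ inv_u0) // coset_fixC // (subsetP sHC).
Qed.

(** By Clifford it is enough to treat the correspondent 'chi_s of 'chi_j in the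
inertia group of 'chi_t.  The element x and its images under P lie in the group
generated by N and x, on which 'chi_s is a sum of P-invariant characters. *)
Lemma irr_over_inv (t : Iirr N) (j : Iirr C) :
    t \in invIirr to N -> t \in irr_constt ('Res[N] 'chi_j) -> j \in invIirr to C.
Proof.
move=> inv_t jNt; pose T := ('I_C['chi_t])%G.
have [s [_ [_ _ Dj sNt _]]] := Clifford_correspondent nsNC (erefl (gval T)) jNt.
have sTC : T \subset C := Inertia_sub _ _.
have sNT : N \subset T := sub_Inertia _ sNC.
have nsNT : N <| T := normalS sNT sTC nsNC.
have nTP : [acts P, on T | to] := acts_inertia sCG nCP inv_t.
have inv_s a x : a \in P -> 'chi_s (to x a) = 'chi_s x.
  move=> Pa; have [Tx | notTx] := boolP (x \in T); last by rewrite !cfun0 ?(act_memE nTP).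
  have /setIP[Cx Ix] := Tx; pose H := (N <*> <[x]>)%G.
  have sNH : N \subset H := joing_subl _ _.
  have sHT : H \subset T by rewrite join_subG sNT cycle_subG.
  have nHP := acts_between sNH (subset_trans sHT sTC).
  have Hx : x \in H by rewrite mem_gen // inE cycle_id orbT.
  rewrite -!(cfResE 'chi_s sHT) ?(act_memE nHP) //.
  rewrite ['Res _]cfun_sum_constt !sum_cfunE; apply: eq_bigr => u Hu.
  have /invIirrP inv_u : u \in invIirr to H.
    apply: (extension_inv inv_t Cx Ix); rewrite constt_Ind_Res.
    have Ns := cfRes_char H (irr_char s).
    have [v uNv] := neq0_has_constt (Res_irr_neq0 N u).
    have:= constt_Res_trans Ns Hu uNv; rewrite cfResRes //.
    rewrite (constt_Res_cfclass _ nsNT sNt) cfclass_IirrE cfclass_invariant ?subsetIr //.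
    by rewrite inE => /eqP/irr_inj <-.
  by rewrite !cfunE inv_u.
apply/invIirrP=> a x Pa Cx; rewrite Dj !cfIndE // -(sum_act nCP _ Pa).
congr (_ * _); apply: eq_bigr => g Cg.
by rewrite -gactJ ?(subsetP sCG) ?inv_s.
Qed.

(** * Rows and columns modulo p *)

(** For f = |'chi_i|^2 the normalized sum over G is |G : N|, which is prime to p,
and that over C is |C : N| times the norm of the restriction.  In this norm only
P-invariant constituents count modulo p. *)
Lemma row_nonzero (i : Iirr G) :
    i \in invIirr to G ->
  exists2 j, j \in invIirr to C & ~~ ('['Res[C] 'chi_i, 'chi_j] == 0 %[mod p])%A.
Proof.
move=> inv_i.
apply/exists_inP; apply: contraLR (coprime_quotient (subxx G)) => /exists_inPn a0.
rewrite prime_coprime // negbK.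
pose f x := 'chi_i x * ('chi_i x)^*.
have invf : {in P & G, forall a x, f (to x a) = f x}.
  by move=> a x Pa Gx; rewrite /f (invIirrP _ _ inv_i).
have Zf : {in G, forall x, #|N|%:R^-1 * (\sum_(n in N) f (x * n)%g) \in Aint}.
  move=> x Gx; have Nchi : 'chi_i * ('chi_i)^*%CF \is a character.
    by rewrite rpredM ?cfConjC_char ?irr_char.
  have := Aint_coset_average nsNG Nchi Gx; congr (_ * _ \in Aint).
  by apply: eq_bigr => n _; rewrite !cfunE.
have := coset_sum_fixC sNG (subxx G) nGP invf Zf.
have -> : #|N|%:R^-1 * (\sum_(x in G) f x) = #|(G / N)%g|%:R.
  have := cfnorm_irr i; rewrite cfdotE => /(canRL (mulVKf (neq0CG G))) ->.
  by rewrite card_quotient // mulr1 mulrC natf_indexg.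
rewrite (setIidPr sCG).
have -> : #|N|%:R^-1 * (\sum_(x in C) f x) = #|(C / N)%g|%:R * '['Res[C] 'chi_i].
  rewrite cfdotE card_quotient ?(subset_trans sCG) // natf_indexg //.
  under [in RHS]eq_bigr => x Cx do rewrite cfResE //.
  by field; rewrite !neq0CG.
rewrite -eqAmod0_nat => eqG; apply: eqAmod_trans eqG _.
rewrite -(mulr0 #|(C / N)%g|%:R); apply: eqAmodMl; first exact: rpred_nat.
have Na (j : Iirr C) : '['Res[C] 'chi_i, 'chi_j] \in Num.nat.
  by rewrite Cnat_cfdot_char_irr ?cfRes_char ?irr_char.
have Za j := Aint_Cnat (Na j).
rewrite cfdot_sum_irr.
apply: (@eqAmod_trans _
  (\sum_(j in invIirr to C) '['Res 'chi_i, 'chi_j] * '['Res 'chi_i, 'chi_j]^*)).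
  apply: (sum_invIirr sCG nCP p_pr pP) => [j | a j k Pa Dk].
    by rewrite rpredM // Aint_conj.
  by rewrite (cfdot_irr_twist nCP Pa (Res_twist sCG nCP inv_i Pa) Dk).
apply: (@eqAmod_trans _ (\sum_(j in invIirr to C) 0)); last by rewrite big1.
apply: eqAmod_sum => j inv_j; rewrite conj_natr // -(mulr0 '['Res 'chi_i, 'chi_j]).
by apply: eqAmodMl => //; apply: negbNE (a0 j inv_j).
Qed.

(** The function f in the proof is constant on cosets of N, with integer values:
f x is the scalar product of a character and a restriction of 'chi_j', both of a
group containing N, times the index of N in that group.  Its sum over G, divided
by |N|, is |C : N|^2 times the scalar product of the restriction to C of
'Ind 'chi_j with 'chi_j'; over C one obtains |C : N|^2 times that of 'chi_j with
'chi_j'. *)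
Lemma column_orthogonality (j j' : Iirr C) :
    j \in invIirr to C -> j' \in invIirr to C ->
  (\sum_(i in invIirr to G) '['Res[C] 'chi_i, 'chi_j] * '['Res[C] 'chi_i, 'chi_j']
     == (j == j')%:R %[mod p])%A.
Proof.
move=> inv_j inv_j'.
have inv_jE a x : a \in P -> 'chi_j (to x a) = 'chi_j x.
  move=> Pa; have [Cx | notCx] := boolP (x \in C); last by rewrite !cfun0 ?(act_memE nCP).
  exact: (invIirrP _ _ inv_j).
pose f g := #|N|%:R^-1 * (\sum_(c in C) 'chi_j (c ^ g)%g * ('chi_j' c)^*).
have invf : {in P & G, forall a x, f (to x a) = f x}.
  move=> a x Pa Gx; congr (_ * _); rewrite -(sum_act nCP _ Pa).
  apply: eq_bigr => c Cc; rewrite (invIirrP _ _ inv_j') //.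
  have Gc := subsetP sCG c Cc; by rewrite -gactJ // inv_jE.
have Zf : {in G, forall x, #|N|%:R^-1 * (\sum_(n in N) f (x * n)%g) \in Aint}.
  move=> x Gx.
  have -> : \sum_(n in N) f (x * n)%g = #|N|%:R * f x.
    rewrite mulr_natl -sumr_const; apply: eq_bigr => n Nn; congr (_ * _).
    have Cn := subsetP sNC n Nn.
    by apply: eq_bigr => c _; rewrite conjgM (cfunJ _ _ Cn).
  rewrite mulKf ?neq0CG // /f.
  pose L := (C :&: C :^ x^-1)%G.
  have sLC : L \subset C := subsetIl _ _.
  have LJ c : c \in L -> (c ^ x)%g \in C by case/setIP=> _; rewrite mem_conjgV.
  have reprL : mx_repr L (fun c => 'Chi_j (c ^ x)%g).
    split=> [|c c' /LJ Lc /LJ Lc']; first by rewrite conj1g repr_mx1.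
    by rewrite conjMg repr_mxM.
  have sNL : N \subset L.
    by rewrite subsetI sNC -sub_conjg (normP _) // (subsetP nNG).
  pose phi := cfRepr (MxRepresentation reprL).
  have -> : \sum_(c in C) 'chi_j (c ^ x)%g * ('chi_j' c)^*
          = #|L|%:R * '[phi, 'Res[L] 'chi_j'].
    rewrite cfdotE mulVKf ?neq0CG // [LHS](big_setID L) /= (setIidPr sLC) addrC big1 ?add0r.
      by apply: eq_bigr => c Lc; rewrite cfResE // cfunE Lc -irrRepr cfunE LJ.
    move=> c /setDP[Cc notLc]; rewrite cfun0 ?mul0r //.
    by apply: contra notLc => Ccx; rewrite inE Cc mem_conjgV.
  rewrite mulrA [_ * #|L|%:R]mulrC -natf_indexg // rpredM ?rpred_nat // Aint_Cnat //.
  by rewrite Cnat_cfdot_char ?cfRepr_char ?cfRes_char ?irr_char.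
have := coset_sum_fixC sNG (subxx G) nGP invf Zf.
have Na (i : Iirr G) k : '['Res[C] 'chi_i, 'chi_k] \in Num.nat.
  by rewrite Cnat_cfdot_char_irr ?cfRes_char ?irr_char.
have Za i k := Aint_Cnat (Na i k).
pose S := \sum_i '['Res[C, G] 'chi_i, 'chi_j] * '['Res[C] 'chi_i, 'chi_j'].
have sumS : (S == \sum_(i in invIirr to G)
    '['Res[C] 'chi_i, 'chi_j] * '['Res[C] 'chi_i, 'chi_j'] %[mod p])%A.
  apply: (sum_invIirr (subxx G) nGP p_pr pP) => [i | a i k Pa Dk]; first by rewrite rpredM.
  have dotE l : l \in invIirr to C -> '['Res[C] 'chi_k, 'chi_l] = '['Res[C] 'chi_i, 'chi_l].
    move=> inv_l; apply: (cfdot_twist nCP Pa) => c Cc; last by rewrite (invIirrP _ _ inv_l).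
    by rewrite !cfResE ?(act_memE nCP) // Dk // (subsetP sCG).
  by rewrite !dotE.
have -> : #|N|%:R^-1 * (\sum_(x in G) f x) = S * (#|(C / N)%g| ^ 2)%N%:R.
  have -> : S = '['Res[C] ('Ind[G] 'chi_j), 'chi_j'].
    rewrite cfdot_Res_l cfdot_char_r ?cfInd_char ?irr_char //.
    apply: eq_bigr => i _; rewrite !cfdot_Res_l.
    rewrite ['['chi_i, _]]cfdotC_char ?cfInd_char ?irr_char //.
    by rewrite ['['chi_i, 'Ind 'chi_j']]cfdotC_char ?cfInd_char ?irr_char.
  rewrite cfdotE natrX card_quotient ?(subset_trans sCG) // natf_indexg // -mulr_sumr.
  rewrite exchange_big /= (eq_bigr (fun c =>
      #|C|%:R * (('Res[C] ('Ind[G] 'chi_j)) c * ('chi_j' c)^*))).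
    by rewrite -mulr_sumr; field; rewrite !neq0CG.
  move=> c Cc; rewrite cfResE // cfIndE // -mulr_suml !mulrA; congr (_ * _).
  by rewrite mulfV ?neq0CG // mul1r.
have -> : #|N|%:R^-1 * (\sum_(x in G :&: C) f x) = (j == j')%:R * (#|(C / N)%g| ^ 2)%N%:R.
  rewrite (setIidPr sCG) (eq_bigr (fun _ => #|N|%:R^-1 * (#|C|%:R * '['chi_j, 'chi_j']))).
    rewrite sumr_const -mulr_natr natrX card_quotient ?(subset_trans sCG) // natf_indexg //.
    by rewrite cfdot_irr; field; rewrite neq0CG.
  move=> g Cg; rewrite cfdotE mulVKf ?neq0CG //; congr (_ * _).
  by apply: eq_bigr => c Cc; rewrite cfunJ.
rewrite /eqAmod -mulrBl -[(_ %| _)%A]eqAmod0 => eqS.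
apply: eqAmod_trans (_ : (S == _ %[mod p])%A); first by rewrite eqAmod_sym.
have ZS : S \in Aint by apply: rpred_sum => i _; rewrite rpredM.
rewrite /eqAmod -eqAmod0; apply: eqAmod0_mulIn eqS; rewrite ?prime_gt0 ?rpredB ?rpred_nat //.
by rewrite coprimeXr // coprime_quotient.
Qed.

(** * The bijection *)

Definition res_mult (i : Iirr G) (j : Iirr C) : nat := Num.truncn '['Res[C] 'chi_i, 'chi_j].

Lemma res_multE i j : '['Res[C] 'chi_i, 'chi_j] = (res_mult i j)%:R.
Proof. by rewrite truncnK // Cnat_cfdot_char_irr ?cfRes_char ?irr_char. Qed.

Definition linked i j := ~~ (p %| res_mult i j)%N.

Lemma linked_col_inj i i' j :
    i \in invIirr to G -> i' \in invIirr to G -> j \in invIirr to C ->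
  linked i j -> linked i' j -> i = i'.
Proof.
move=> inv_i inv_i' inv_j lij li'j; apply/eqP; apply: contraLR lij => ne_ii'.
have := column_uniqueness inv_i inv_i' inv_j ne_ii'.
by rewrite !res_multE -natrM eqAmod0_nat Euclid_dvdM // (negPf li'j) orbF negbK.
Qed.

Lemma linked_row_exists i : i \in invIirr to G -> exists2 j, j \in invIirr to C & linked i j.
Proof.
by case/row_nonzero=> j inv_j; rewrite res_multE eqAmod0_nat; exists j.
Qed.

Lemma res_mult_orthogonality j j' : j \in invIirr to C -> j' \in invIirr to C ->
  (\sum_(i in invIirr to G) res_mult i j * res_mult i j' = (j == j') %[mod p])%N.
Proof.
move=> inv_j inv_j'; apply/eqP; have := column_orthogonality inv_j inv_j'.
rewrite (eq_bigr (fun i => (res_mult i j * res_mult i j')%N%:R)) => [|i _].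
  by rewrite -natr_sum eqAmod_nat.
by rewrite !res_multE natrM.
Qed.

Lemma linked_col_exists j : j \in invIirr to C -> exists2 i, i \in invIirr to G & linked i j.
Proof.
move=> inv_j; apply/exists_inP; apply: contraT => /exists_inPn no_i.
have := res_mult_orthogonality inv_j inv_j; rewrite eqxx (modn_small (prime_gt1 p_pr)) => sum1.
have : (p %| \sum_(i in invIirr to G) res_mult i j * res_mult i j)%N.
  by rewrite dvdn_sum // => i /no_i/negbNE dv_p; rewrite dvdn_mull.
by rewrite /dvdn sum1.
Qed.

(** Modulo p only one term of [res_mult_orthogonality] survives, as the column of
j has no other entry prime to p. *)
Lemma res_mult_linked i j j' : i \in invIirr to G -> j \in invIirr to C -> j' \in invIirr to C ->
  linked i j -> (res_mult i j * res_mult i j' = (j == j') %[mod p])%N.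
Proof.
move=> inv_i inv_j inv_j' lij.
rewrite -(res_mult_orthogonality inv_j inv_j') (bigD1 i) //= -modnDmr.
have /eqP-> : (p %| \sum_(i' in invIirr to G | i' != i) res_mult i' j * res_mult i' j')%N.
  apply: dvdn_sum => i' /andP[inv_i' ne_i'i]; rewrite dvdn_mulr //.
  by apply: contraNT ne_i'i => li'j; apply/eqP; apply: linked_col_inj li'j lij.
by rewrite addn0.
Qed.

Lemma linked_row_inj i j j' :
    i \in invIirr to G -> j \in invIirr to C -> j' \in invIirr to C ->
  linked i j -> linked i j' -> j = j'.
Proof.
move=> inv_i inv_j inv_j' lij lij'; apply/eqP; apply: contraLR lij' => /negPf ne_jj'.
have := res_mult_linked inv_i inv_j inv_j' lij; rewrite ne_jj' mod0n => /eqP.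
by rewrite -/(dvdn _ _) Euclid_dvdM // (negPf lij) negbK.
Qed.

(** The square of the entry is 1 modulo p by [res_mult_linked] with j' = j. *)
Lemma linked_sign i j :
    i \in invIirr to G -> j \in invIirr to C -> linked i j ->
  ((res_mult i j)%:Z = 1 %[mod p%:Z])%Z \/ ((res_mult i j)%:Z = -1 %[mod p%:Z])%Z.
Proof.
move=> inv_i inv_j lij; have := res_mult_linked inv_i inv_j inv_j lij.
set m := res_mult i j; rewrite eqxx /= => m2.
have : (p%:Z %| (m%:Z - 1) * (m%:Z + 1))%Z.
  rewrite -subr_sqr expr1n -eqz_mod_dvd expr2 -PoszM.
  by rewrite !modz_nat m2.
rewrite dvdzE abszM Euclid_dvdM // -!dvdzE => /orP[]; rewrite -?[(m%:Z + 1)]/(m%:Z - (-1)).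
  by rewrite -eqz_mod_dvd => /eqP; left.
by rewrite -eqz_mod_dvd => /eqP; right.
Qed.

Definition star i : Iirr C := odflt 0 [pick j in invIirr to C | linked i j].

Lemma starP i : i \in invIirr to G -> star i \in invIirr to C /\ linked i (star i).
Proof.
move/linked_row_exists=> [j inv_j lij]; rewrite /star.
by case: pickP => [k /andP[] // | /(_ j)]; rewrite inv_j lij.
Qed.

Lemma star_unique i j : i \in invIirr to G -> j \in invIirr to C -> linked i j -> j = star i.
Proof. by move=> inv_i inv_j lij; have [inv_s ls] := starP inv_i; apply: linked_row_inj ls. Qed.

Lemma star_inj : {in invIirr to G &, injective star}.
Proof.
move=> i i' inv_i inv_i' eq_s; have [[inv_s ls] [_ ls']] := (starP inv_i, starP inv_i').
by apply: linked_col_inj ls _; rewrite // eq_s.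
Qed.

Lemma star_onto : star @: invIirr to G = invIirr to C.
Proof.
apply/setP=> j; apply/imsetP/idP=> [[i inv_i ->] | inv_j]; first by case: (starP inv_i).
by have [i inv_i lij] := linked_col_exists inv_j; exists i; rewrite // -(star_unique _ _ lij).
Qed.

(** A constituent other than the one linked to 'chi_i has multiplicity divisible
by p as soon as it is P-invariant, and [irr_over_inv] gives the P-invariance of
those over P-invariant characters of N. *)
Lemma star_decomp i : i \in invIirr to G ->
  exists (Delta Xi : 'CF(C)), res_decomp to p N i (star i) (res_mult i (star i))%:Z Delta Xi.
Proof.
move=> inv_i; have [inv_s ls] := starP inv_i.
pose over_inv j := [exists t in invIirr to N, t \in irr_constt ('Res[N] 'chi[C]_j)].
exists (\sum_(j | over_inv j && (j != star i)) (res_mult i j %/ p)%N%:R *: 'chi_j).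
exists (\sum_(j | ~~ over_inv j) (res_mult i j)%:R *: 'chi_j).
split.
- by apply: rpred_sum => j _; rewrite rpredZ_nat ?irr_char.
- by apply: rpred_sum => j _; rewrite rpredZ_nat ?irr_char.
- rewrite {1}['Res _]cfun_sum_cfdot (bigID over_inv) /= (bigD1 (star i)) /=; last first.
        by apply/exists_inP; apply: invariant_constt_exists.
  congr (_ + _ + _); first by rewrite res_multE.
    rewrite scaler_sumr; apply: eq_bigr => j /andP[/exists_inP[t inv_t jNt] ne_js].
    rewrite scalerA -natrM mulnC divnK -?res_multE //.
    apply: contraNT ne_js => lij; apply/eqP/star_unique => //.
    exact: irr_over_inv jNt.
  by apply: eq_bigr => j _; rewrite res_multE.
- by rewrite dvdzE.
move=> k t Xi_k inv_t; apply: contraL Xi_k => kNt.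
rewrite irr_consttE negbK cfdot_suml big1 // => j not_over.
rewrite cfdotZl cfdot_irr; case: eqP not_over => [-> | _ _]; last by rewrite mulr0.
by case/existsP; exists t; rewrite inv_t.
Qed.

(** The character 'chi_j lies over a P-invariant character of N, so it is no
constituent of Xi.  Its multiplicity in the restriction is then e modulo p, which
is not 0. *)
Lemma star_of_decomp i j (e : int) (Delta Xi : 'CF(C)) :
    i \in invIirr to G -> j \in invIirr to C ->
  res_decomp to p N i j e Delta Xi -> j = star i.
Proof.
move=> inv_i inv_j [NDelta NXi Dres pe XiN]; apply: star_unique => //.
have [t inv_t jNt] := invariant_constt_exists sNC sCG nCP inv_j.
have Xi_j : '[Xi, 'chi_j] = 0.
  by apply/eqP; apply: contraLR jNt => Xi_j; apply: XiN.
apply: contra pe => dv_p; have := res_multE i j.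
rewrite Dres !cfdotDl Xi_j !cfdotZl cfnorm_irr mulr1 addr0.
have /natrP[d ->] := Cnat_cfdot_char_irr j NDelta.
move/(canRL (addrK _)) => De.
have {}De : e = (res_mult i j)%:Z - (p%:Z * d%:Z).
  by apply: (@intr_inj algC); rewrite De rmorphB rmorphM /= !pmulrn.
by rewrite De rpredB ?dvdz_mulr // dvdzE.
Qed.

(** * Fields, values and blocks *)

Lemma aut_inv (u : {rmorphism algC -> algC}) (H : {group gT}) (i : Iirr H) :
  i \in invIirr to H -> aut_Iirr u i \in invIirr to H.
Proof.
by move/invIirrP=> inv_i; apply/invIirrP=> a x Pa Hx; rewrite aut_IirrE !cfunE inv_i.
Qed.

Lemma star_aut (u : {rmorphism algC -> algC}) i :
  i \in invIirr to G -> star (aut_Iirr u i) = aut_Iirr u (star i).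
Proof.
move=> inv_i; have [inv_s ls] := starP inv_i.
apply/esym/star_unique; rewrite ?aut_inv // /linked.
suffices -> : res_mult (aut_Iirr u i) (aut_Iirr u (star i)) = res_mult i (star i) by [].
apply/eqP; rewrite -eqC_nat -!res_multE !aut_IirrE -cfAutRes cfdot_aut_char ?irr_char //.
by rewrite res_multE rmorph_nat.
Qed.

(** As [star] is injective and commutes with field automorphisms, 'chi_i and
'chi_(star i) are fixed by the same ones. *)
Lemma star_char_field i z :
  i \in invIirr to G -> in_char_field 'chi_i z <-> in_char_field 'chi_(star i) z.
Proof.
move=> inv_i; have [inv_s _] := starP inv_i.
have dvC : {in C, forall x, (#[x] %| #|G|)%N}.
  by move=> x Cx; rewrite order_dvdG // (subsetP sCG).
have dvG : {in G, forall x, (#[x] %| #|G|)%N} by move=> x; apply: order_dvdG.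
have autE (u : {rmorphism algC -> algC}) (H : {group gT}) (k : Iirr H) :
    cfAut u 'chi_k = 'chi_k <-> aut_Iirr u k = k.
  by split=> [uk | uk]; [apply: irr_inj; rewrite aut_IirrE | rewrite -aut_IirrE uk].
split=> Kz K closedK valK; apply: (Kz K closedK).
  apply: (subfield_of_values (irr_char (star i)) (irr_char i) dvC dvG) valK => // u.
  rewrite !autE -star_aut // => /star_inj; apply=> //; exact: aut_inv.
apply: (subfield_of_values (irr_char i) (irr_char (star i)) dvG dvC) valK => // u.
by rewrite !autE -star_aut // => ->.
Qed.

(** Conjugate constituents of the restriction take the same value at a fixed point
of P, so only the P-invariant ones count modulo p; among these all but
'chi_(star i) have multiplicity divisible by p. *)
Lemma star_fixed_value i x : i \in invIirr to G -> x \in G -> {in P, forall a, to x a = x} ->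
  ('chi_i x == (res_mult i (star i))%:R * 'chi_(star i) x %[mod p])%A.
Proof.
move=> inv_i Gx fix_x; have Cx := fixed_memC Gx fix_x; have [inv_s ls] := starP inv_i.
rewrite -(cfResE 'chi_i sCG Cx) ['Res _]cfun_sum_cfdot sum_cfunE.
pose F j := '['Res[C] 'chi_i, 'chi_j] * 'chi_j x.
have Zmult j : '['Res[C] 'chi_i, 'chi_j] \in Aint by rewrite res_multE rpred_nat.
rewrite (eq_bigr F) => [|j _]; last by rewrite cfunE.
apply: (@eqAmod_trans _ (\sum_(j in invIirr to C) F j)).
  apply: (sum_invIirr sCG nCP p_pr pP) => [j | a j k Pa Dk].
    by rewrite rpredM // Aint_irr.
  rewrite /F (cfdot_irr_twist nCP Pa (Res_twist sCG nCP inv_i Pa) Dk).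
  by rewrite Dk // fix_x.
rewrite (bigD1 (star i)) //= /F res_multE -[X in (_ == X %[mod _])%A]addr0 eqAmodDl.
apply: (@eqAmod_trans _ (\sum_(j in invIirr to C | j != star i) 0)); last by rewrite big1.
apply: eqAmod_sum => j /andP[inv_j ne_j]; rewrite -(mul0r ('chi_j x)).
apply: eqAmodMr; rewrite ?Aint_irr // res_multE eqAmod0_nat.
by apply: contraNT ne_j => lij; apply/eqP/star_unique.
Qed.

(** The number of Sylow subgroups of N is 1 modulo p, so P fixes one of them. *)
Lemma invariant_Sylow_exists : exists S : {group gT},
  [/\ p.-Sylow(N) S & [acts P, on S | to]].
Proof.
pose SS : {set {set gT}} := [set (gval Q : {set gT}) | Q in 'Syl_p(N)].
have SSP (A : {set gT}) : reflect (exists2 Q : {group gT}, p.-Sylow(N) Q & A = Q) (A \in SS).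
  by apply: (iffP imsetP) => -[Q sylQ ->]; exists Q; rewrite // ?inE // -inE in sylQ *.
have cardSS : (#|SS| %% p = 1)%N.
  by rewrite card_imset ?card_Syl_mod // => Q R; apply: group_inj.
have nN a : a \in P -> (to^*)%act N a = N.
  by move=> Pa; apply: astabs_setact; apply: (subsetP nNP).
have actSS : {in SS & P, forall A a, (to^*)%act A a \in SS}.
  move=> _ a /SSP[Q sylQ ->] Pa; apply/SSP.
  have sQN := pHall_sub sylQ; have sQG := subset_trans sQN sNG.
  exists (actm to a @* Q)%G; last by rewrite /= morphim_actm.
  have := morphim_pHall (act_morphism to a) sQG sylQ.
  by rewrite /= (morphim_actm _ Pa sNG) nN.
have := @pgroup_sum_fix p aT P P _ (to^*)%act SS (fun _ => 1) p_pr pP (subxx P) actSS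
  (fun _ _ => rpred1 _) (fun _ _ _ _ => erefl).
rewrite !sumr_const eqAmod_nat cardSS.
have [A /andP[/SSP[S sylS ->]] /afixP fixS _ | no_fix] :=
  pickP [pred A in SS | A \in 'Fix_(to^*)(P)].
  exists S; split=> //; apply/subsetP=> a Pa; rewrite !inE Pa; apply/subsetP=> x Sx.
  by rewrite inE -(fixS a Pa) mem_setact.
by rewrite (eq_card0 no_fix) mod0n.
Qed.

(** Both characters are tested by [principal_blockP] with the same P-invariant S,
which is Sylow in N, C and G.  The subgroup U of C_G(S) is then P-invariant, and
P has the same fixed points on U and on U :&: C. *)
Lemma star_principal_block i :
    i \in invIirr to G -> ~~ (p %| 'chi_i 1%g)%C ->
  (in_principal_block p i <-> in_principal_block p (star i)).
Proof.
move=> inv_i p'i; have [inv_s ls] := starP inv_i.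
have [S [sylSN nSP]] := invariant_Sylow_exists.
have sSN := pHall_sub sylSN; have sSG := subset_trans sSN sNG; have sSC := subset_trans sSN sNC.
have sylSG : p.-Sylow(G) S.
  rewrite pHallE sSG /= (card_Hall sylSN) -(Lagrange sNG) -card_quotient // partnM ?cardG_gt0 //.
  by rewrite [X in (_ * X)%N]part_p'nat ?muln1.
have sylSC : p.-Sylow(C) S := pHall_subl sSC sCG sylSG.
have sZH : 'Z(S) \subset 'C_G(S) by rewrite subsetI (subset_trans (center_sub S)) // subsetIr.
have nsZH : 'Z(S) <| 'C_G(S).
  apply: sub_center_normal; rewrite subsetI sZH (subset_trans (center_sub S)) //.
  by rewrite centsC subsetIr.
have sylZ : p.-Sylow('C_G(S)) 'Z(S).
  have sylSN' : p.-Sylow('N_G(S)) S.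
    by apply: pHall_subl sylSG; rewrite ?subsetIl // subsetI sSG normG.
  have -> : 'Z(S) = S :&: 'C_G(S) by rewrite setIA (setIidPl sSG).
  exact: Hall_setI_normal (subcent_normal G S) sylSN'.
(* Z(S) is a normal Sylow subgroup of C_G(S), so it has a complement. *)
have [U p'U defH] : exists2 U : {group gT}, p^'.-group U & ('Z(S) * U = 'C_G(S))%g.
  have /splitsP[U /complP[tiU defH]] := SchurZassenhaus_split (pHall_Hall sylZ) nsZH.
  exists U => //; have /and3P[_ _ p'ZH] := sylZ.
  by rewrite /pgroup -(mulnK #|U| (cardG_gt0 'Z(S))) mulnC -TI_cardMg // defH divgS.
have defHC : ('Z(S) * (U :&: C) = 'C_C(S))%g.
  rewrite group_modl ?(subset_trans (center_sub S)) // defH setIC setIA.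
  by rewrite (setIidPl sCG).
have p'UC : p^'.-group (U :&: C) := pgroupS (subsetIl _ _) p'U.
have p's : ~~ (p %| 'chi_(star i) 1%g)%C.
  have := star_fixed_value inv_i (group1 G) (fun a Pa => gact1 to Pa).
  move: p'i; have /natrP[n ->] := Cnat_irr1 i; have /natrP[n' ->] := Cnat_irr1 (star i).
  rewrite -natrM eqAmod_nat !dvdC_nat => p'n /eqP eq_n; apply: contra p'n => dv_n'.
  by rewrite /dvdn eq_n -/(dvdn _ _) dvdn_mull.
pose a (H : {group gT}) (k : Iirr H) (V : {set gT}) := \sum_(u in V) 'chi_k u.
suffices eqU : (a G i U == (res_mult i (star i))%:R * a C (star i) (U :&: C) %[mod p])%A.
  have eq_a : (a G i U == 0 %[mod p])%A = (a C (star i) (U :&: C) == 0 %[mod p])%A.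
    rewrite (eqAmod_transl _ eqU); apply/idP/idP.
      rewrite mulrC; apply: eqAmod0_mulIn; rewrite ?prime_gt0 ?prime_coprime //.
      by apply: rpred_sum => u _; apply: Aint_irr.
    by move/(eqAmodMl (rpred_nat _ (res_mult i (star i)))); rewrite mulr0.
  split=> block M maxM Mp.
    apply/(principal_blockP p_pr sylSC p'UC defHC p's maxM Mp).
    apply: contra (_ : ~~ (a G i U == 0 %[mod p])%A); first by rewrite eq_a.
    by apply/(principal_blockP p_pr sylSG p'U defH p'i maxM Mp); apply: block.
  apply/(principal_blockP p_pr sylSG p'U defH p'i maxM Mp).
  apply: contra (_ : ~~ (a C (star i) (U :&: C) == 0 %[mod p])%A); first by rewrite -eq_a.
  by apply/(principal_blockP p_pr sylSC p'UC defHC p's maxM Mp); apply: block.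
have sUH : U \subset 'C_G(S) by rewrite -defH mulG_subr.
have sUG := subset_trans sUH (subsetIl _ _).
have nUP : [acts P, on U | to].
  apply/subsetP=> b Pb; rewrite !inE Pb; apply/subsetP=> u Uu; rewrite inE.
  have Gu := subsetP sUG u Uu; have Gub : to u b \in G by rewrite (gact_stable to Pb).
  apply: (p'elt_centralizer sylSG p'U defH).
    rewrite inE Gub; apply/centP=> s Ss.
    have Ss' : to s b^-1%g \in S by rewrite (act_memE nSP) ?groupV.
    have /setIP[_ cSu] := subsetP sUH u Uu; have Gs' := subsetP sSG _ Ss'.
    rewrite -(actKVin to Pb s) /commute -!gactM //.
    by rewrite (centP cSu).
  have := mem_p_elt p'U Uu; rewrite /p_elt.
  by rewrite -(order_injm (injm_actm to b) Gu) /= actmE.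
have nUCP : [acts P, on U :&: C | to] := actsI nUP nCP.
rewrite /a; apply: (@eqAmod_trans _ (\sum_(u in U | u \in 'Fix_to(P)) 'chi_i u)).
  apply: pgroup_sum_fix => // [u b Uu Pb | u _ | u b Uu Pb].
  - by rewrite (act_memE nUP).
  - exact: Aint_irr.
  by rewrite (invIirrP _ _ inv_i) // (subsetP sUG).
apply: (@eqAmod_trans _ ((res_mult i (star i))%:R *
  (\sum_(u in U :&: C | u \in 'Fix_to(P)) 'chi_(star i) u))).
  rewrite mulr_sumr (eq_bigl (fun u => (u \in U :&: C) && (u \in 'Fix_to(P)))) => [|u].
    apply: eqAmod_sum => u /andP[/setIP[Uu _] /afixP fix_u].
    by apply: star_fixed_value; rewrite // (subsetP sUG).
  rewrite in_setI -andbA; apply: andb_id2l => Uu; rewrite andb_idl // => /afixP fix_u.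
  by apply: fixed_memC fix_u; apply: (subsetP sUG).
apply: eqAmodMl; rewrite ?rpred_nat // eqAmod_sym.
apply: pgroup_sum_fix => // [u b Uu Pb | u _ | u b /setIP[_ Cu] Pb].
- by rewrite (act_memE nUCP).
- exact: Aint_irr.
by rewrite (invIirrP _ _ inv_s).
Qed.

End RelativeGlauberman.

Theorem theoremE (p : nat) (aT gT : finGroupType)
    (P : {group aT}) (G N C : {group gT}) (to : groupAction P G)
    (p_pr : prime p) (pP : p.-group P)
    (nsNG : N <| G) (nNP : [acts P, on N | to]) (p'GN : p^'.-group (G / N)%g)
    (sNC : N \subset C) (sCG : C \subset G)
    (defC : (C / N)%g = 'C_(|to / N)(P)%g) :
  exists star : Iirr G -> Iirr C,
    [/\ {in invIirr to G &, injective star},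
        star @: invIirr to G = invIirr to C
      & forall i : Iirr G, i \in invIirr to G ->
        [/\ exists (e : int) (Delta Xi : 'CF(C)),
              res_decomp to p N i (star i) e Delta Xi
              /\ ((e = 1 %[mod p%:Z])%Z \/ (e = -1 %[mod p%:Z])%Z),
            forall j : Iirr C, j \in invIirr to C ->
              (exists (e : int) (Delta Xi : 'CF(C)),
                 res_decomp to p N i j e Delta Xi) ->
              j = star i,
            forall z : algC,
              in_char_field 'chi_i z <-> in_char_field 'chi_(star i) z
          & ~~ (p %| 'chi_i 1%g)%C ->
              (in_principal_block p i <-> in_principal_block p (star i))]].
Proof.
exists (star p C to); split.
- exact: star_inj p'GN.
- exact: star_onto p'GN.
move=> i inv_i; split.
- have [Delta [Xi decomp]] := star_decomp p_pr pP nsNG nNP sNC sCG defC p'GN inv_i.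
  exists (res_mult i (star p C to i)), Delta, Xi; split=> //.
  have [inv_s ls] := starP p_pr pP nsNG nNP sNC sCG defC p'GN inv_i.
  exact: (linked_sign p_pr pP nsNG nNP sNC sCG defC p'GN inv_i inv_s ls).
- move=> j inv_j [e [Delta [Xi decomp]]].
  exact: (star_of_decomp p_pr pP nsNG nNP sNC sCG defC p'GN inv_i inv_j decomp).
- move=> z; exact: (star_char_field p_pr pP nsNG nNP sNC sCG defC p'GN z inv_i).
by move=> p'i; exact: (star_principal_block p_pr pP nsNG nNP sNC sCG defC p'GN inv_i p'i).
Qed.
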